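(* Let $\alpha \ge 0$. For each $n \ge 1$, let $T_n$ be a $\mathrm{BGW}(2,1/2)$ tree conditioned to have exactly $n$ vertices, and suppose that, given $T_n$, $\lfloor \alpha n \rfloor$ cars arrive one at a time, each car independently choosing a uniformly random vertex of $T_n$ at which it attempts to park, according to the parking process. Let $A_{n,\alpha}$ be the event that all $\lfloor \alpha n \rfloor$ of the arriving cars can park on $T_n$. Then $$\lim_{n \rightarrow \infty} \mathbb{P}(A_{n, \alpha}) = \begin{cases} e^{\alpha/2} \sqrt{\dfrac{\alpha^2 - 4\alpha + 2}{2(1-\alpha)}} & \text{if } 0 \leq \alpha \leq 2-\sqrt{2}, \\[2mm] 0 & \text{if } \alpha > 2-\sqrt{2}. \end{cases}$$
   Context: $\mathrm{BGW}(2,1/2)$ denotes the law of the family tree of a Galton–Watson branching process (started from a single root individual) with $\mathrm{Bin}(2,1/2)$ offspring distribution, i.e. each individual independently has $0,1,2$ children with probabilities $1/4,1/2,1/4$. Trees are rooted, with each edge directed from a vertex to its parent (towards the root). Parking process on a finite rooted tree: each vertex is a parking space holding at most one car. Cars arrive one by one, each at its chosen vertex. If that vertex is unoccupied the car parks there; otherwise it follows the unique directed path towards the root and parks at the first unoccupied vertex it encounters. If it finds no unoccupied vertex on the path up to and including the root, it leaves the tree through the root without parking. ''All cars can park'' means that no car leaves the tree. *)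

(* Defs.v *)
From HB Require Import structures.
From mathcomp Require Import all_boot all_order all_algebra.
From mathcomp Require Import all_classical all_reals all_analysis.

Set Implicit Arguments.
Unset Strict Implicit.
Unset Printing Implicit Defensive.

Import Order.TTheory GRing.Theory Num.Theory.
Import numFieldNormedType.Exports.

Local Open Scope classical_set_scope.
Local Open Scope ring_scope.

(* The family tree of a branching process: an individual together with the
   sequence of the family trees of its children. *)
Inductive tree : Type := Node of seq tree.

(* A vertex is denoted by its Ulam-Harris address: [::] is the root, and the
   children of u are rcons u 0, rcons u 1, ... *)
Definition vertex : Type := seq nat.

HB.instance Definition _ := Countable.on vertex.
HB.instance Definition _ := isPointed.Build vertex [::].

Fixpoint vertices (t : tree) : seq vertex :=
  let: Node ts := t in
  [::] :: flatten [seq [seq iu.1 :: v | v <- iu.2]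
                  | iu <- zip (iota 0 (size ts)) (map vertices ts)].

Definition tree_size (t : tree) : nat := size (vertices t).


Fixpoint tree_encode (t : tree) : GenTree.tree unit :=
  let: Node ts := t in GenTree.Node 0 (map tree_encode ts).

Fixpoint tree_decode (g : GenTree.tree unit) : tree :=
  if g is GenTree.Node _ gs then Node (map tree_decode gs) else Node [::].

Lemma tree_encodeK : cancel tree_encode tree_decode.
Proof.
rewrite /cancel; fix IH 1 => -[ts] /=; congr Node.
elim: ts => //= t ts IHts; by rewrite IH IHts.
Qed.

HB.instance Definition _ := Countable.copy tree (can_type tree_encodeK).
HB.instance Definition _ := isPointed.Build tree (Node [::]).


HB.instance Definition _ := @isMeasurable.Build default_measure_display
  tree discrete_measurable discrete_measurable0
  discrete_measurableC discrete_measurableU.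

HB.instance Definition _ := @isMeasurable.Build default_measure_display
  vertex discrete_measurable discrete_measurable0
  discrete_measurableC discrete_measurableU.

Section branching_process.
Context {R : realType}.

(* Individuals reproduce independently with offspring law mu: the root has
   size ts children with probability mu (size ts), and the trees of their
   descendants are then independent copies of the whole tree. *)
Fixpoint gw_pmf (mu : nat -> R) (t : tree) : R :=
  let: Node ts := t in mu (size ts) * \prod_(x <- map (gw_pmf mu) ts) x.

Definition gw_law (mu : nat -> R) (A : set tree) : \bar R :=
  \esum_(t in A) (gw_pmf mu t)%:E.

Definition BGW (k : nat) (p : R) : set tree -> \bar R :=
  gw_law (binomial_pmf k p).

Definition conditioned (Q : set tree -> \bar R) (B A : set tree) : R :=
  fine (Q (A `&` B)) / fine (Q B).

Definition uniform_vertex (t : tree) (v : vertex) : R :=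
  if v \in vertices t then (tree_size t)%:R^-1 else 0.

End branching_process.

(* v, the parent of v, ..., the root. *)
Definition path_to_root (v : vertex) : seq vertex :=
  [seq take k v | k <- rev (iota 0 (size v).+1)].

(* The place where a car arriving at v parks when the vertices in occ are
   occupied, or None if it leaves the tree through the root. *)
Definition parking_place (occ : seq vertex) (v : vertex) : option vertex :=
  ohead [seq u <- path_to_root v | u \notin occ].

(* The outcomes for the cars with successive arrival vertices s. *)
Fixpoint parking (occ s : seq vertex) : seq (option vertex) :=
  if s is v :: s' then
    let o := parking_place occ v in
    o :: parking (if o is Some u then u :: occ else occ) s'
  else [::].

Definition all_cars_park (s : seq vertex) : bool :=
  all isSome (parking [::] s).

Section random_parking.
Context {R : realType} d (Omega : measurableType d) (P : probability Omega R).

Definition is_conditioned_BGW (n : nat) (T : {RV P >-> tree}) : Prop :=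
  forall t : tree, P [set w | T w = t] =
    (conditioned (BGW 2 (2^-1 : R)) [set t' | tree_size t' = n] [set t])%:E.

(* Given T, the X i are independent and uniform over the vertices of T. *)
Definition iid_uniform_given (m : nat) (T : {RV P >-> tree})
    (X : 'I_m -> {RV P >-> vertex}) : Prop :=
  forall (t : tree) (s : 'I_m -> vertex),
    P [set w | T w = t /\ forall i, X i w = s i] =
    (P [set w | T w = t] * (\prod_(i < m) uniform_vertex t (s i))%:E)%E.

Definition all_park_event (m : nat) (X : 'I_m -> {RV P >-> vertex}) :
    set Omega :=
  [set w | all_cars_park [seq X i w | i <- enum 'I_m]].

End random_parking.

(* Main.v *)
(* Give every vertex Poisson(a) cars and let z n j be the weight of the trees
   with n vertices from which j cars leave.  Splitting at the root gives a
   recursion for z, in which an occupied root absorbs one car.  Its double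
   generating function W x y satisfies an equation which is quadratic in W and
   has y as a catalytic variable.  For 0 < x < 1 its discriminant is a square
   on [0, 1] with a zero y inside, hence a double zero: this yields
   x = exp(a (1 - y)) y d(y) and W x 0 = 2 exp(a y / 2) sqrt(1 - a y) / d(y),
   with d(y) = 2 - (1 + a) y + a y^2.  As y goes to 1, x goes to 1 with
   1 - x quadratic in 1 - y when a < 2 - sqrt 2, so that W x 0 has a square root
   singularity at x = 1, as has the generating function W x 1 of all trees.

   The probability q n that no car leaves a tree with n vertices is the ratio
   of the coefficients of W x 0 and W x 1.  It is nonincreasing: by Luczak and
   Winkler, a uniform binary tree with n + 1 vertices is obtained from one with
   n vertices by adding a leaf, which can only increase the number of cars that
   leave.  Hence q n converges, and an Abelian argument identifies its limit as
   the ratio of the two singularities.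

   Conditioning on the total number of cars, q n is a Poisson mixture of the
   probabilities for a fixed number m of cars, which are nonincreasing in m.
   Chernoff bounds for a slightly below and slightly above alpha then give the
   limit for m = floor (alpha n); above the threshold the limit vanishes by
   monotonicity, because it already vanishes at 2 - sqrt 2. *)

Require Import Defs.
From mathcomp Require Import all_boot all_order all_algebra.
From mathcomp Require Import all_classical all_reals all_analysis.
From mathcomp Require Import ring lra.

Set Implicit Arguments.
Unset Strict Implicit.
Unset Printing Implicit Defensive.

Import Order.TTheory GRing.Theory Num.Theory.
Import numFieldNormedType.Exports.

Local Open Scope classical_set_scope.
Local Open Scope ring_scope.

(** * Sizes of the subtrees of a random binary tree *)

Definition convn (A : pzSemiRingType) (f g : nat -> A) (n : nat) : A :=
  \sum_(i < n.+1) f i * g (n - i)%N.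

Section catalan.
Context {R : realFieldType}.

(** The Catalan number $C_n$ divided by $4^n$. For $n \ge 1$ this is the probability that the
    branching tree has $n$ vertices, see [sum_bgw_weight]. *)
Fixpoint catalan4 (n : nat) : R :=
  if n is m.+1 then catalan4 m * (2 * m%:R + 1) / (2 * (m%:R + 2)) else 1.

Lemma catalan4_gt0 n : 0 < catalan4 n.
Proof.
elim: n => //= m IH; have h : (0 : R) <= m%:R := ler0n _ m.
by rewrite divr_gt0 ?mulr_gt0 //; lra.
Qed.

(** The law $C_k C_{m-k} / C_{m+1}$ of the size of the left subtree of a uniform binary tree with
    [m.+1] vertices; the factor 4 comes from the normalization of [catalan4]. *)
Definition left_size_pmf (m k : nat) : R :=
  catalan4 k * catalan4 (m - k) / (4 * catalan4 m.+1).

(* The probability that, in the Luczak-Winkler growth of a uniform binary tree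
   from m.+1 to m.+2 vertices, the new leaf joins a left subtree of size k. *)
Definition grow_left (m k : nat) : R :=
  (k%:R + 1) * (2 * k%:R + 1) * (3 * m%:R + 3 - 2 * k%:R)
  / ((m%:R + 1) * (m%:R + 2) * (2 * m%:R + 3)).

Lemma left_size_pmf_ge0 m k : 0 <= left_size_pmf m k.
Proof.
by rewrite divr_ge0 ?mulr_ge0 // ltW ?catalan4_gt0.
Qed.

Lemma grow_left_ge0 m k : (k <= m)%N -> 0 <= grow_left m k.
Proof.
move=> km; have h : (0 : R) <= k%:R := ler0n _ k.
have h2 : (k%:R : R) <= m%:R by rewrite ler_nat.
by rewrite /grow_left divr_ge0 ?mulr_ge0 //; lra.
Qed.

(** Reflecting the tree exchanges left and right. This also shows that the complementary probability
    is nonnegative. *)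
Lemma grow_left_sym m k : (k <= m)%N ->
  1 - grow_left m k = grow_left m (m - k).
Proof.
move=> km; rewrite /grow_left natrB //.
have h : (0 : R) <= m%:R := ler0n _ m.
by field; rewrite !gt_eqF //; lra.
Qed.

Lemma left_size_grow0 m :
  left_size_pmf m.+1 0 = left_size_pmf m 0 * (1 - grow_left m 0).
Proof.
rewrite /left_size_pmf /grow_left !subn0 /= -natr1.
have h : (0 : R) <= m%:R := ler0n _ m.
have hc : catalan4 m != 0 by rewrite gt_eqF ?catalan4_gt0.
by field; rewrite hc !gt_eqF //; lra.
Qed.

Lemma left_size_grow_max m :
  left_size_pmf m.+1 m.+1 = left_size_pmf m m * grow_left m m.
Proof.
rewrite /left_size_pmf /grow_left !subnn /= -natr1.
have h : (0 : R) <= m%:R := ler0n _ m.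
have hc : catalan4 m != 0 by rewrite gt_eqF ?catalan4_gt0.
by field; rewrite hc !gt_eqF //; lra.
Qed.

(** One growth step: the leaf goes right of a left subtree of size [k.+1], or joins a left subtree
    of size [k]. Once [catalan4] is unfolded this is a rational identity in [k] and [j]. *)
Lemma left_size_grow m k : (k < m)%N ->
  left_size_pmf m.+1 k.+1 = left_size_pmf m k.+1 * (1 - grow_left m k.+1)
                          + left_size_pmf m k * grow_left m k.
Proof.
move=> km; have [j ->] : exists j, m = (k.+1 + j)%N.
  by exists (m - k.+1)%N; rewrite subnKC.
rewrite /left_size_pmf /grow_left.
have -> : ((k.+1 + j).+1 - k.+1 = j.+1)%N by rewrite -addnS addKn.
have -> : (k.+1 + j - k.+1 = j)%N by rewrite addKn.
have -> : (k.+1 + j - k = j.+1)%N by rewrite addSn -addnS addKn.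
rewrite !addSn /=.
have hc n : catalan4 n != 0 by rewrite gt_eqF ?catalan4_gt0.
move: (catalan4 k) (hc k) (catalan4 j) (hc j) => Ck hCk Cj hCj.
rewrite -!natr1 natrD.
have hj : (0 : R) <= j%:R := ler0n _ j.
have hk : (0 : R) <= k%:R := ler0n _ k.
by field; rewrite hc !gt_eqF //; lra.
Qed.

Lemma left_size_grow_sum m (F : nat -> R) :
  \sum_(k < m.+2) left_size_pmf m.+1 k * F k =
  \sum_(k < m.+1) left_size_pmf m k *
     ((1 - grow_left m k) * F k + grow_left m k * F k.+1).
Proof.
have -> : \sum_(k < m.+1) left_size_pmf m k *
     ((1 - grow_left m k) * F k + grow_left m k * F k.+1) =
  \sum_(k < m.+1) left_size_pmf m k * (1 - grow_left m k) * F k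
  + \sum_(k < m.+1) left_size_pmf m k * grow_left m k * F k.+1.
  rewrite -big_split; apply: eq_bigr => k _ /=.
  by rewrite mulrDr; congr (_ + _); rewrite -mulrA.
rewrite big_ord_recl big_ord_recr [X in _ = X + _]big_ord_recl.
rewrite [X in _ = _ + X]big_ord_recr /= left_size_grow0 left_size_grow_max.
rewrite -[RHS]addrA; congr (_ + _); rewrite [RHS]addrA; congr (_ + _).
rewrite -big_split; apply: eq_bigr => i _ /=.
by rewrite /bump add1n left_size_grow // mulrDl.
Qed.

(** Growth preserves the total mass, so induction from the one-vertex tree suffices. Catalan's
    convolution identity [catalan4_conv] is a corollary. *)
Lemma left_size_pmf_sum m : \sum_(k < m.+1) left_size_pmf m k = 1.
Proof.
elim: m => [|m IH].
  by rewrite big_ord1 /left_size_pmf subnn /=; field.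
rewrite -[RHS]IH; have := left_size_grow_sum m (fun=> 1).
have -> : \sum_(k < m.+2) left_size_pmf m.+1 k * 1 =
          \sum_(k < m.+2) left_size_pmf m.+1 k.
  by apply: eq_bigr => k _; rewrite mulr1.
by move=> ->; apply: eq_bigr => k _; rewrite !mulr1 subrK mulr1.
Qed.

Lemma catalan4_conv n :
  4 * catalan4 n.+1 = convn catalan4 catalan4 n.
Proof.
have h := catalan4_gt0 n.+1.
have <- : 4 * catalan4 n.+1 * (\sum_(k < n.+1) left_size_pmf n k)
          = convn catalan4 catalan4 n.
  rewrite mulr_sumr; apply: eq_bigr => k _.
  by rewrite /left_size_pmf; field; rewrite gt_eqF.
by rewrite left_size_pmf_sum mulr1.
Qed.

End catalan.

(** * Convolutions and partial sums *)

Section convolution.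
Context {A : comPzRingType}.
Implicit Types f g h : nat -> A.

Lemma convC f g n : convn f g n = convn g f n.
Proof.
rewrite /convn (reindex_inj rev_ord_inj) /=; apply: eq_bigr => i _.
by rewrite subSS subKn 1?mulrC // -ltnS.
Qed.

Lemma eq_conv f f' g g' n : (forall i, (i <= n)%N -> f i = f' i) ->
  (forall i, (i <= n)%N -> g i = g' i) -> convn f g n = convn f' g' n.
Proof.
move=> ef eg; apply: eq_bigr => i _.
by rewrite ef ?eg ?leq_subr // -ltnS.
Qed.

Definition cumul f n : A := \sum_(i < n.+1) f i.

Lemma cumulS f n : cumul f n.+1 = cumul f n + f n.+1.
Proof. by rewrite /cumul big_ord_recr. Qed.

Lemma cumul_conv f g n : cumul (convn f g) n = convn f (cumul g) n.
Proof.
have cumul0 h : cumul h 0 = h 0%N by rewrite /cumul big_ord1.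
elim: n => [|n IH]; first by rewrite cumul0 /convn !big_ord1 cumul0.
rewrite cumulS IH /convn (big_ord_recr n.+1) (big_ord_recr n.+1) /=.
rewrite subnn cumul0 addrA; congr (_ + _).
rewrite -big_split; apply: eq_bigr => i _ /=.
by rewrite subSn ?cumulS ?mulrDr // -ltnS.
Qed.

End convolution.

(** * The number of cars that leave is stochastically increasing *)

(** The cars that reach the root of a tree with [n.+1] vertices before the root absorbs one.
    Subtrees of size 0 are allowed, so an only child on the left differs from one on the right. *)
Definition arrivals (A : pzSemiRingType) (q : A) (po : nat -> A)
    (z : nat -> nat -> A) (n j : nat) : A :=
  q * convn po (fun i => \sum_(k < n.+1) convn (z k) (z (n - k)%N) i) j.

Definition park_one (A : nmodType) (f : nat -> A) (j : nat) : A :=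
  if j is 0 then f 0%N + f 1%N else f j.+1.

(* z n j is the total weight of the trees with n vertices (the empty tree for
   n = 0) from which j cars leave, when a vertex is given weight q and receives
   i cars with weight po i. *)
Definition overflow_law (A : pzSemiRingType) (q : A) (po : nat -> A)
    (z : nat -> nat -> A) :=
  (forall j, z 0%N j = (j == 0)%:R) /\
  (forall n j, z n.+1 j = park_one (arrivals q po z n) j).

(** At most [n] cars leave exactly when at most [n.+1] reach the root. *)
Lemma cumul_park_one (A : comPzRingType) (f : nat -> A) n :
  cumul (park_one f) n = cumul f n.+1.
Proof.
elim: n => [|n IH]; last by rewrite !cumulS IH cumulS.
by rewrite /cumul big_ord1 !big_ord_recr big_ord0 /= add0r.
Qed.

Section stochastic_monotonicity.
Context {R : realFieldType} (po : nat -> R) (z : nat -> nat -> R).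
Hypothesis po_ge0 : forall i, 0 <= po i.
Hypothesis po_le1 : forall n, cumul po n <= 1.
Hypothesis z_law : overflow_law 4^-1 po z.

Let c : nat -> R := catalan4.
Let c_gt0 n : 0 < c n. Proof. exact: catalan4_gt0. Qed.

Lemma conv_ge0 (f g : nat -> R) n : (forall i, 0 <= f i) ->
  (forall i, (i <= n)%N -> 0 <= g i) -> 0 <= convn f g n.
Proof.
move=> f0 g0; apply: sumr_ge0 => i _; apply: mulr_ge0 => //.
by apply: g0; exact: leq_subr.
Qed.

Lemma overflow_law_ge0 n j : 0 <= z n j.
Proof.
have [z0 zS] := z_law.
elim/ltn_ind: n j => -[|n] IH j; first by rewrite z0 ler0n.
have h i : 0 <= arrivals 4^-1 po z n i.
  apply: mulr_ge0; first by rewrite invr_ge0.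
  apply: conv_ge0 => // l _; apply: sumr_ge0 => k _.
  apply: sumr_ge0 => m _; apply: mulr_ge0; apply: IH => //.
  by rewrite ltnS leq_subr.
by rewrite zS /park_one; case: j => // ; rewrite addr_ge0.
Qed.

(** Normalized distribution functions of the overflow: [F n] for one tree with [n] vertices,
    [Cdf k l] for the total from two independent trees. *)
Let F n j := cumul (z n) j / c n.
Let Cdf k l J := convn (z k) (cumul (z l)) J / (c k * c l).

Let Cdf_sym k l J : Cdf k l J = Cdf l k J.
Proof.
rewrite /Cdf -!cumul_conv [c l * _]mulrC; congr (_ / _).
by apply: eq_bigr => i _; rewrite convC.
Qed.

Let Cdf_le k l l' J : (forall j, F l' j <= F l j) ->
  Cdf k l' J <= Cdf k l J.
Proof.
move=> h.
have E m : Cdf k m J = (c k)^-1 * \sum_(i < J.+1) z k i * F m (J - i).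
  rewrite /Cdf /convn mulr_suml mulr_sumr; apply: eq_bigr => i _.
  by rewrite /F; field; rewrite !gt_eqF.
rewrite !E ler_wpM2l ?invr_ge0 ?(ltW (c_gt0 _)) // ler_sum // => i _.
by rewrite ler_wpM2l ?overflow_law_ge0.
Qed.

Let F_rec n j :
  F n.+1 j = \sum_(a < j.+2) po a *
     (\sum_(k < n.+1) left_size_pmf n k * Cdf k (n - k) (j.+1 - a)).
Proof.
rewrite /F; have [_ zS] := z_law.
have -> : cumul (z n.+1) j = cumul (park_one (arrivals 4^-1 po z n)) j.
  by apply: eq_bigr => i _; rewrite zS.
rewrite cumul_park_one /arrivals /cumul -mulr_sumr.
rewrite -/(cumul (convn _ _) _) cumul_conv mulrC mulrA /convn mulr_sumr.
apply: eq_bigr => a _; rewrite mulrCA; congr (_ * _).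
rewrite /cumul exchange_big mulr_sumr; apply: eq_bigr => k _ /=.
rewrite -/(cumul (convn _ _) _) cumul_conv /left_size_pmf /Cdf -/c.
rewrite -[_ / (2 * (n%:R + 2))]/(c n.+1).
by move: (c n.+1) (c_gt0 n.+1) => C hC; field; rewrite !gt_eqF.
Qed.

(** Strong induction along the Luczak-Winkler growth: growing a tree grows exactly one of the two
    subtrees of the root. By induction this lowers the distribution function of that subtree's
    overflow, and convolving with nonnegative weights keeps the inequality. *)
Lemma overflow_law_nonincreasing n j :
  cumul (z n.+1) j / catalan4 n.+1 <= cumul (z n) j / catalan4 n.
Proof.
have [z0 _] := z_law; rewrite -/c -/(F n.+1 j) -/(F n j).
have F0 i : F 0 i = 1.
  rewrite /F divr1 /cumul big_ord_recl big1 ?addr0 ?z0 // => k _.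
elim/ltn_ind: n j => -[|n] IH j.
  (* The empty tree loses no car, so its distribution function is 1 everywhere. *)
  rewrite F0 F_rec (le_trans _ (po_le1 j.+1)) // ler_sum // => a _.
  rewrite big_ord1 ler_piMr // subnn.
  have := left_size_pmf_sum (R := R) 0; rewrite big_ord1 => ->.
  rewrite mul1r /Cdf -cumul_conv !mulr1 invr1 mulr1.
  rewrite /cumul big_ord_recl big1 => [|k _].
    by rewrite /convn big_ord1 !z0 mulr1 addr0.
  rewrite /convn big1 // => l _; rewrite !z0.
  case: (nat_of_ord l) => [|l']; last by rewrite mul0r.
  by rewrite mul1r subn0.
rewrite !F_rec ler_sum // => a _; rewrite ler_wpM2l //.
(* The larger tree is now described by the left size [k] of the smaller one and by the side of the
   new leaf: [t1] treats the right side, [t2] the left. *)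
rewrite (left_size_grow_sum n (fun k => Cdf k (n.+1 - k) (j.+1 - a))).
apply: ler_sum => k _; have kn : (k <= n)%N by rewrite -ltnS.
rewrite ler_wpM2l ?left_size_pmf_ge0 //.
rewrite subSn // subSS; set T := Cdf k (n - k) _.
have t1 : Cdf k (n - k).+1 (j.+1 - a) <= T.
  by apply: Cdf_le => i; apply: IH; rewrite ltnS leq_subr.
have t2 : Cdf k.+1 (n - k) (j.+1 - a) <= T.
  rewrite /T; rewrite [Cdf k.+1 _ _]Cdf_sym [Cdf k _ _]Cdf_sym.
  by apply: Cdf_le => i; apply: IH; rewrite ltnS.
have g0 := grow_left_ge0 (R := R) kn.
have g1 : 0 <= (1 - grow_left n k : R).
  by rewrite grow_left_sym // grow_left_ge0 // leq_subr.
rewrite -[leRHS](subrK (grow_left n k * T)).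
rewrite lerD //; last by rewrite ler_wpM2l.
by rewrite -{1}[T]mul1r -mulrBl ler_wpM2l.
Qed.

End stochastic_monotonicity.

(** * Series with nonnegative terms *)

Section nonneg_series.
Context {R : realType}.
Implicit Types (f g : nat -> R) (S x : R).

Record sums f S : Prop := Sums { sums_cvg : cumul f n @[n --> \oo] --> S }.

Lemma sums_unique f S S' : sums f S -> sums f S' -> S = S'.
Proof. by move=> [h] [h']; apply: cvg_unique h h'; exact: norm_hausdorff. Qed.

Lemma eq_sums f g S : f =1 g -> sums f S -> sums g S.
Proof. by move=> /funext ->. Qed.

Lemma sums_series f S : series f n @[n --> \oo] --> S -> sums f S.
Proof.
move=> h; split.
have -> : cumul f = (fun n => series f n.+1).
  by apply/funext => n; rewrite /series /= big_mkord.
by rewrite (cvg_shiftS (series f)).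
Qed.

Lemma sumsZ (k : R) f S : sums f S -> sums (fun n => k * f n) (k * S).
Proof.
move=> [h]; split.
have -> : cumul (fun n => k * f n) = (fun n => k * cumul f n).
  by apply/funext => n; rewrite /cumul mulr_sumr.
exact: cvgMr.
Qed.

Lemma sumsD f g S S' : sums f S -> sums g S' ->
  sums (fun n => f n + g n) (S + S').
Proof.
move=> [h] [h']; split.
have -> : cumul (fun n => f n + g n) = (fun n => cumul f n + cumul g n).
  by apply/funext => n; rewrite /cumul big_split.
exact: cvgD.
Qed.

Lemma sums0 f : (forall n, f n = 0) -> sums f 0.
Proof.
move=> f0; split; have -> : cumul f = (fun=> 0).
  by apply/funext => m; rewrite /cumul big1.
exact: cvg_cst.
Qed.

Lemma sums_sum n (f : nat -> nat -> R) (S : nat -> R) :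
  (forall k, (k < n)%N -> sums (f k) (S k)) ->
  sums (fun i => \sum_(k < n) f k i) (\sum_(k < n) S k).
Proof.
elim: n => [|n IH] h.
  by rewrite big_ord0; apply: sums0 => i; exact: big_ord0.
rewrite big_ord_recr; apply: (@eq_sums (fun i => \sum_(k < n) f k i + f n i)).
  by move=> i; rewrite big_ord_recr.
by apply: sumsD; [apply: IH => k kn; apply: h; rewrite ltnS ltnW | apply: h].
Qed.

Lemma sums_behead f S : sums (fun n => f n.+1) S <-> sums f (f 0%N + S).
Proof.
have E n : cumul f n.+1 = f 0%N + cumul (fun n => f n.+1) n.
  by rewrite /cumul big_ord_recl.
split=> -[h]; split; [rewrite -(cvg_shiftS (cumul f))|
  move: h; rewrite -(cvg_shiftS (cumul f)) => h].
  rewrite (_ : (fun n => _) = (fun n => f 0%N + cumul (fun n => f n.+1) n)).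
    by apply: cvgD h; exact: cvg_cst.
  exact/funext.
rewrite (_ : cumul _ = (fun n => - f 0%N + cumul f n.+1)).
  by rewrite -[X in _ --> X](addKr (f 0%N)); apply: cvgD h; exact: cvg_cst.
by apply/funext => n; rewrite E addKr.
Qed.

Lemma ler_cumul f g n : (forall i, f i <= g i) -> cumul f n <= cumul g n.
Proof. by move=> h; apply: ler_sum. Qed.

Lemma cumul_homo f : (forall n, 0 <= f n) ->
  {homo cumul f : n m / (n <= m)%N >-> n <= m}.
Proof.
move=> f0; apply: homo_leq => [//| m n p|n]; first exact: le_trans.
by rewrite cumulS lerDl.
Qed.

Lemma cumul_le_sums f S n : (forall n, 0 <= f n) -> sums f S ->
  cumul f n <= S.
Proof.
move=> f0 [h]; rewrite -(cvg_lim (@norm_hausdorff _ _) h).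
by apply: nondecreasing_cvgn_le; [exact: cumul_homo | exact: cvgP h].
Qed.

Lemma sums_ub f S M : sums f S -> (forall n, cumul f n <= M) -> S <= M.
Proof.
move=> [h] hM; rewrite -(cvg_lim (@norm_hausdorff _ _) h).
by apply: limr_le; [exact: cvgP h | exact: nearW].
Qed.

Lemma sums_ge0 f S : (forall n, 0 <= f n) -> sums f S -> 0 <= S.
Proof.
move=> f0 /(cumul_le_sums 0 f0); apply: le_trans.
by rewrite /cumul big_ord1.
Qed.

Lemma ler_sums f g S S' : (forall i, 0 <= g i) -> (forall i, f i <= g i) ->
  sums f S -> sums g S' -> S <= S'.
Proof.
move=> g0 fg h h'; apply: sums_ub h _ => n.
by apply: le_trans (cumul_le_sums n g0 h'); exact: ler_cumul.
Qed.

Lemma sums_bounded f M : (forall n, 0 <= f n) -> (forall n, cumul f n <= M) ->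
  exists S, sums f S.
Proof.
move=> f0 fM; exists (limn (cumul f)); split; apply: nondecreasing_is_cvgn.
  exact: cumul_homo.
by exists M => _ [n _ <-].
Qed.

Lemma sums_dominated f g S : (forall n, 0 <= f n) -> (forall n, f n <= g n) ->
  sums g S -> exists S', sums f S'.
Proof.
move=> f0 fg h; apply: (@sums_bounded f S f0) => n.
have g0 i : 0 <= g i by exact: le_trans (fg i).
by apply: le_trans (cumul_le_sums n g0 h); exact: ler_cumul.
Qed.

(** The triangle $i + j \le n$ lies in the square of side $n$, which lies in the triangle $i + j \le
    2n$. With nonnegative terms this squeezes the partial sums. *)
Lemma sums_conv f g S S' : (forall n, 0 <= f n) -> (forall n, 0 <= g n) ->
  sums f S -> sums g S' -> sums (convn f g) (S * S').
Proof.
move=> f0 g0 hf hg.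
have cg0 n : 0 <= cumul g n by apply: sumr_ge0.
have fg0 n : 0 <= convn f g n.
  by apply: sumr_ge0 => i _; apply: mulr_ge0.
have hfg : (cumul f n * cumul g n) @[n --> \oo] --> S * S'.
  by apply: cvgM; exact: sums_cvg.
have ub n : cumul (convn f g) n <= cumul f n * cumul g n.
  rewrite cumul_conv /convn mulr_suml; apply: ler_sum => i _.
  by rewrite ler_wpM2l // cumul_homo // leq_subr.
have ub' n : cumul f n * cumul g n <= S * S'.
  rewrite ler_pM //; [exact: sumr_ge0 | exact: cumul_le_sums..].
have lb n : cumul f n * cumul g n <= cumul (convn f g) (n + n)%N.
  rewrite cumul_conv /convn mulr_suml -addSn big_split_ord /=.
  rewrite ler_wpDr //; first by apply: sumr_ge0 => i _; exact: mulr_ge0.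
  apply: ler_sum => i _; rewrite ler_wpM2l // cumul_homo //.
  by rewrite -addnBA ?leq_addr // -ltnS.
have [L hL] := sums_bounded fg0 (fun n => le_trans (ub n) (ub' n)).
suff -> : S * S' = L by [].
apply/eqP; rewrite eq_le; apply/andP; split; last first.
  by apply: (sums_ub hL) => n; exact: le_trans (ub' n).
rewrite -(cvg_lim (@norm_hausdorff _ _) hfg).
apply: limr_le; first exact: cvgP hfg.
by apply: nearW => n; apply: le_trans (lb n) _; exact: cumul_le_sums.
Qed.

Lemma sums_limn f S : sums f S -> sums f (limn (cumul f)).
Proof. by move=> [/cvgP h]; split. Qed.

End nonneg_series.
Arguments sumsZ {R} k {f S} _.

(** * Generating functions of the overflow *)

Section generating_functions.
Context {R : realType}.

Definition poisson_wt (a : R) (i : nat) : R := expR (- a) * exp_coeff a i.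

Lemma sums_exp_coeff (x : R) : sums (exp_coeff x) (expR x).
Proof. by apply: sums_series; exact: is_cvg_series_exp_coeff. Qed.

Lemma sums_poisson_wt (a y : R) :
  sums (fun i => poisson_wt a i * y ^+ i) (expR (a * (y - 1))).
Proof.
have -> : a * (y - 1) = - a + a * y by rewrite mulrBr mulr1 addrC.
rewrite expRD; apply: (eq_sums _ (sumsZ _ (sums_exp_coeff (a * y)))) => i.
by rewrite /poisson_wt /exp_coeff /= exprMn; ring.
Qed.

Lemma convn_pow (f g : nat -> R) (y : R) n :
  convn (fun i => f i * y ^+ i) (fun i => g i * y ^+ i) n
  = convn f g n * y ^+ n.
Proof.
rewrite /convn mulr_suml; apply: eq_bigr => i _.
by rewrite mulrACA -exprD subnKC // -ltnS.
Qed.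

(** The partial sums satisfy $S_{n+1} \le 1 + S_n^2/4$, and 2 is the fixed point of $s \mapsto 1 +
    s^2/4$. *)
Lemma cumul_catalan4_le2 n : cumul catalan4 n <= 2 :> R.
Proof.
elim: n => [|n IH]; first by rewrite /cumul big_ord1 /= ler1n.
have c0 m : 0 <= catalan4 m :> R by rewrite ltW ?catalan4_gt0.
rewrite /cumul big_ord_recl /=.
have -> : \sum_(i < n.+1) catalan4 (bump 0 i) =
    4^-1 * cumul (convn catalan4 catalan4) n :> R.
  rewrite /cumul mulr_sumr; apply: eq_bigr => i _.
  by rewrite -catalan4_conv mulKf.
have h : cumul (convn catalan4 catalan4) n <= 2 * 2 :> R.
  have s0 : 0 <= cumul catalan4 n :> R by apply: sumr_ge0.
  apply: (@le_trans _ _ (cumul catalan4 n * cumul catalan4 n)).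
    rewrite cumul_conv /convn mulr_suml; apply: ler_sum => i _.
    by rewrite ler_wpM2l // cumul_homo // leq_subr.
  by rewrite ler_pM.
by lra.
Qed.

Variables (a : R) (z : nat -> nat -> R).
Hypothesis a_ge0 : 0 <= a.
Hypothesis z_law : overflow_law 4^-1 (poisson_wt a) z.

Lemma poisson_wt_ge0 i : 0 <= poisson_wt a i.
Proof. by rewrite mulr_ge0 ?expR_ge0 ?exp_coeff_ge0. Qed.

Let z_ge0 n j : 0 <= z n j.
Proof. exact: (overflow_law_ge0 poisson_wt_ge0 z_law). Qed.

Let zpow_ge0 (y : R) n j : 0 <= y -> 0 <= z n j * y ^+ j.
Proof. by move=> y0; rewrite mulr_ge0 // exprn_ge0. Qed.

Lemma sums_arrivals (y : R) n (h : nat -> R) : 0 <= y ->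
  (forall k, (k <= n)%N -> sums (fun j => z k j * y ^+ j) (h k)) ->
  sums (fun j => arrivals 4^-1 (poisson_wt a) z n j * y ^+ j)
       (4^-1 * (expR (a * (y - 1)) * convn h h n)).
Proof.
move=> y0 hh.
apply: (@eq_sums _ (fun j => 4^-1 * convn (fun i => poisson_wt a i * y ^+ i)
   (fun i => (\sum_(k < n.+1) convn (z k) (z (n - k)%N) i) * y ^+ i) j)).
  by move=> j; rewrite convn_pow /arrivals mulrA.
apply: sumsZ; apply: sums_conv.
- by move=> i; rewrite mulr_ge0 ?poisson_wt_ge0 ?exprn_ge0.
- move=> i; rewrite mulr_ge0 ?exprn_ge0 // sumr_ge0 // => k _.
  by rewrite sumr_ge0 // => m _; rewrite mulr_ge0.
- exact: sums_poisson_wt.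
pose zy k i := z k i * y ^+ i.
apply: (@eq_sums _ (fun i => \sum_(k < n.+1) convn (zy k) (zy (n - k)%N) i)).
  move=> i; rewrite mulr_suml; apply: eq_bigr => k _.
  by rewrite convn_pow.
apply: (sums_sum (f := fun k => convn (zy k) (zy (n - k)%N))
                 (S := fun k => h k * h (n - k)%N)) => k kn.
by apply: sums_conv => [i|i||]; rewrite ?zpow_ge0 //; apply: hh; rewrite ?leq_subr.
Qed.

(** Absorbing a car divides by $y$, except that the term without cars is kept; this gives the
    correction $(1-y) f_0$. Multiplying through by $y$ includes $y = 0$. *)
Lemma sums_park_one (f : nat -> R) (y S : R) :
  sums (fun j => f j * y ^+ j) S ->
  sums (fun j => y * (park_one f j * y ^+ j)) (S - (1 - y) * f 0%N).
Proof.
move=> h; have := sums_behead (fun j => f j * y ^+ j) (S - f 0%N).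
rewrite expr0 mulr1 subrKC => /iffRL /(_ h) h1.
have h2 : sums (fun j => (j == 0%N)%:R * (f 0%N * y)) (f 0%N * y).
  have /iffLR := sums_behead (fun j => (j == 0%N)%:R * (f 0%N * y)) 0.
  rewrite mul1r addr0; apply.
  by apply: sums0 => j; rewrite mul0r.
have -> : S - (1 - y) * f 0%N = S - f 0%N + f 0%N * y by ring.
apply: (eq_sums _ (sumsD h1 h2)) => -[|j] /=.
  by rewrite mul1r expr1 expr0; ring.
by rewrite mul0r addr0 [in LHS]exprS; ring.
Qed.

(** At $y = 1$ the correction of [sums_park_one] vanishes and the recursion becomes Catalan's,
    whatever the value of [a]. *)
Lemma sums_overflow1 n : sums (z n) (catalan4 n).
Proof.
have [z0 zS] := z_law.
elim/ltn_ind: n => -[|n] IH.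
  have /iffLR := sums_behead (z 0) 0; rewrite z0 addr0; apply.
  by apply: sums0 => j; rewrite z0.
have hh k : (k <= n)%N -> sums (fun j => z k j * 1 ^+ j) (catalan4 k).
  move=> kn; apply: (eq_sums _ (IH k kn)) => j.
  by rewrite expr1n mulr1.
have := sums_park_one (sums_arrivals (ler01 : (0:R) <= 1) hh).
rewrite subrr mulr0 mul0r subr0 expR0 mul1r -catalan4_conv mulKf ?pnatr_eq0 //.
by apply: eq_sums => j; rewrite zS expr1n mulr1 mul1r.
Qed.

Definition ygf (y : R) (n : nat) : R := limn (cumul (fun j => z n j * y ^+ j)).

Lemma sums_ygf (y : R) n : 0 <= y <= 1 ->
  sums (fun j => z n j * y ^+ j) (ygf y n).
Proof.
case/andP=> y0 y1.
have [||S hS] := @sums_dominated _ (fun j => z n j * y ^+ j) _ _ _ _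
  (sums_overflow1 n).
- by move=> j; exact: zpow_ge0.
- by move=> j; rewrite ler_piMr // exprn_ile1.
exact: sums_limn hS.
Qed.

Lemma ygf_ge0 y n : 0 <= y <= 1 -> 0 <= ygf y n.
Proof.
move=> /[dup] /andP[y0 y1] yI; apply: sums_ge0 (sums_ygf n yI) => j.
exact: zpow_ge0.
Qed.

Lemma ler_ygf y y' n : 0 <= y -> y <= y' -> y' <= 1 -> ygf y n <= ygf y' n.
Proof.
move=> y0 yy' y'1; have y'0 := le_trans y0 yy'.
apply: (ler_sums (f := fun j => z n j * y ^+ j)
                 (g := fun j => z n j * y' ^+ j)); last 2 first.
- by apply: sums_ygf; rewrite y0 (le_trans yy').
- by apply: sums_ygf; rewrite y'0.
- by move=> j; exact: zpow_ge0.
- by move=> j; rewrite ler_wpM2l // lerXn2r.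
Qed.

Lemma ygf1 n : ygf 1 n = catalan4 n.
Proof.
have := @sums_ygf 1 n; rewrite ler01 lexx => /(_ erefl) h.
apply: sums_unique h _; apply: (eq_sums _ (sums_overflow1 n)) => j.
by rewrite expr1n mulr1.
Qed.

Lemma ygf_le y n : 0 <= y <= 1 -> ygf y n <= catalan4 n.
Proof. by move=> /andP[y0 y1]; rewrite -ygf1 ler_ygf. Qed.

Lemma ygf_at0 n : ygf 0 n = z n 0%N.
Proof.
have := @sums_ygf 0 n; rewrite lexx ler01 => /(_ erefl) h.
apply: sums_unique h _; split.
have -> : cumul (fun j => z n j * 0 ^+ j) = (fun=> z n 0%N).
  apply/funext => m; rewrite /cumul big_ord_recl big1 ?expr0 ?mulr1 ?addr0 //.
  by move=> i _; rewrite exprS mul0r mulr0.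
exact: cvg_cst.
Qed.

Lemma ygf_0 y : ygf y 0 = 1.
Proof.
have [z0 _] := z_law; rewrite /ygf.
have -> : cumul (fun j => z 0 j * y ^+ j) = (fun=> 1 : R).
  apply/funext => m; rewrite /cumul big_ord_recl big1 ?z0 ?expr0 ?mulr1 ?addr0 //.
  by move=> i _; rewrite z0 mul0r.
by apply: cvg_lim; [exact: norm_hausdorff | exact: cvg_cst].
Qed.

Lemma ygf_rec y n : 0 <= y <= 1 ->
  y * ygf y n.+1 + (1 - y) * arrivals 4^-1 (poisson_wt a) z n 0%N =
  4^-1 * (expR (a * (y - 1)) * convn (ygf y) (ygf y) n).
Proof.
move=> /[dup] /andP[y0 y1] yI; have [_ zS] := z_law.
have h1 := sums_park_one (sums_arrivals (n := n) y0 (fun k _ => sums_ygf k yI)).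
have h2 := sumsZ y (sums_ygf n.+1 yI).
rewrite (sums_unique h2 (eq_sums _ h1)) ?subrK // => j.
by rewrite zS.
Qed.

Definition xygf (x y : R) : R := limn (cumul (fun n => ygf y n * x ^+ n)).

Lemma sums_xygf x y : 0 <= x <= 1 -> 0 <= y <= 1 ->
  sums (fun n => ygf y n * x ^+ n) (xygf x y).
Proof.
move=> /andP[x0 x1] yI.
have f0 n : 0 <= ygf y n * x ^+ n by rewrite mulr_ge0 ?ygf_ge0 ?exprn_ge0.
have [|S hS] := @sums_bounded _ (fun n => ygf y n * x ^+ n) 2 f0.
  move=> n; apply: le_trans (cumul_catalan4_le2 n); apply: ler_cumul => i.
  by apply: le_trans (ygf_le i yI); rewrite ler_piMr ?ygf_ge0 // exprn_ile1.
exact: sums_limn hS.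
Qed.

Lemma xygf_ge0 x y : 0 <= x <= 1 -> 0 <= y <= 1 -> 0 <= xygf x y.
Proof.
move=> /[dup] /andP[x0 x1] xI yI; apply: sums_ge0 (sums_xygf xI yI) => n.
by rewrite mulr_ge0 ?ygf_ge0 ?exprn_ge0.
Qed.

Lemma ler_xygf x y y' : 0 <= x <= 1 -> 0 <= y -> y <= y' -> y' <= 1 ->
  xygf x y <= xygf x y'.
Proof.
move=> /[dup] /andP[x0 x1] xI y0 yy' y'1; have y'0 := le_trans y0 yy'.
have yI : 0 <= y <= 1 by rewrite y0 (le_trans yy').
have y'I : 0 <= y' <= 1 by rewrite y'0.
apply: ler_sums (sums_xygf xI yI) (sums_xygf xI y'I).
- by move=> j; rewrite mulr_ge0 ?ygf_ge0 ?exprn_ge0.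
- by move=> j; rewrite ler_wpM2r ?exprn_ge0 ?ler_ygf.
Qed.

Lemma xygf_ge1 x y : 0 <= x <= 1 -> 0 <= y <= 1 -> 1 <= xygf x y.
Proof.
move=> /[dup] /andP[x0 x1] xI yI.
apply: le_trans (cumul_le_sums 0 _ (sums_xygf xI yI)).
  by rewrite /cumul big_ord1 ygf_0 mul1r expr0.
by move=> n; rewrite mulr_ge0 ?ygf_ge0 ?exprn_ge0.
Qed.

Lemma xygf_le2 x y : 0 <= x <= 1 -> 0 <= y <= 1 -> xygf x y <= 2.
Proof.
move=> /[dup] /andP[x0 x1] xI yI; apply: sums_ub (sums_xygf xI yI) _ => n.
apply: le_trans (cumul_catalan4_le2 n); apply: ler_cumul => i.
by apply: le_trans (ygf_le i yI); rewrite ler_piMr ?ygf_ge0 // exprn_ile1.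
Qed.

(* Tutte's equation with catalytic variable y. *)
Lemma xygf_equation x y : 0 <= x <= 1 -> 0 <= y <= 1 ->
  y * (xygf x y - 1) + (1 - y) * (x / 4 * expR (- a) * xygf x 0 ^+ 2) =
  x / 4 * expR (a * (y - 1)) * xygf x y ^+ 2.
Proof.
move=> /[dup] /andP[x0 x1] xI yI.
have sq u : 0 <= u <= 1 ->
    sums (fun n => convn (ygf u) (ygf u) n * x ^+ n) (xygf x u ^+ 2).
  move=> uI; rewrite expr2.
  apply: (@eq_sums _ (convn (fun n => ygf u n * x ^+ n)
                            (fun n => ygf u n * x ^+ n))).
    by move=> n; rewrite convn_pow.
  by apply: sums_conv; [move=> n; rewrite mulr_ge0 ?ygf_ge0 ?exprn_ge0 ..
    | exact: sums_xygf | exact: sums_xygf].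
have I0 : 0 <= (0 : R) <= 1 by rewrite lexx ler01.
have f0 := sumsZ (x / 4 * expR (- a)) (sq 0 I0).
have hW : sums (fun n => ygf y n.+1 * x ^+ n.+1) (xygf x y - 1).
  apply/(sums_behead (fun n => ygf y n * x ^+ n)).
  by rewrite ygf_0 mul1r expr0 subrKC; exact: sums_xygf.
apply: sums_unique (sumsD (sumsZ y hW) (sumsZ (1 - y) f0)) _.
apply: (eq_sums _ (sumsZ _ (sq y yI))) => n.
(* The recursion at $y = 0$ expresses the unknown weight of no car reaching the root through
   [ygf 0]. *)
have := ygf_rec n yI; have := ygf_rec n I0.
rewrite !mul0r add0r subr0 mul1r sub0r mulrN1 => ->; rewrite exprS => h.
have -> : x / 4 * expR (a * (y - 1)) * (convn (ygf y) (ygf y) n * x ^+ n)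
   = x * x ^+ n * (4^-1 * (expR (a * (y - 1)) * convn (ygf y) (ygf y) n)).
  by ring.
by rewrite -h; ring.
Qed.

End generating_functions.

(** * The kernel method *)

(** Knaster-Tarski on $[0,1]$: the supremum of the [t] with [t <= m t] is fixed. Monotonicity takes
    the place of continuity of the generating function in $y$. *)
Lemma monotone_fixpoint (R : realType) (m : R -> R) :
  (forall t u, 0 <= t -> t <= u -> u <= 1 -> m t <= m u) ->
  0 < m 0 -> m 1 < 1 -> exists2 y : R, 0 < y < 1 & m y = y.
Proof.
move=> m_homo m0 m1.
have m01 t : 0 <= t <= 1 -> 0 <= m t <= 1.
  move=> /andP[t0 t1]; apply/andP; split.
    exact: (le_trans (ltW m0) (m_homo _ _ (lexx 0) t0 t1)).
  exact: (le_trans (m_homo _ _ t0 t1 (lexx 1)) (ltW m1)).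
pose S : set R := [set t : R | 0 <= t <= 1 /\ t <= m t].
have S0 : S 0 by split; rewrite ?lexx ?ler01 ?ltW.
have Sub : has_ubound S by exists 1 => t [/andP[]].
pose y := sup S.
have y0 : 0 <= y by exact: ub_le_sup.
have y1 : y <= 1 by apply: ge_sup; [exists 0 | move=> t [/andP[]]].
have ym : y <= m y.
  apply: ge_sup; first by exists 0.
  move=> t [/andP[t0 t1] tm]; apply: (le_trans tm); apply: (m_homo _ _ t0 _ y1).
  by apply: (ub_le_sup Sub); split; rewrite ?t0.
have myI : 0 <= m y <= 1 by rewrite m01 // y0.
have my : m y <= y.
  have /andP[_ my1] := myI.
  by apply: (ub_le_sup Sub); split; last exact: (m_homo _ _ y0 ym my1).
have e : m y = y by apply/eqP; rewrite eq_le my ym.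
exists y => //; rewrite -e; apply/andP; split.
  exact: (lt_le_trans m0 (m_homo _ _ (lexx 0) y0 y1)).
exact: (le_lt_trans (m_homo _ _ y0 y1 (lexx 1)) m1).
Qed.

Section kernel_method.
Context {R : realType} (a : R) (z : nat -> nat -> R).
Hypothesis a_ge0 : 0 <= a.
Hypothesis z_law : overflow_law 4^-1 (poisson_wt a) z.

Definition kernel_den (y : R) : R := 2 - (1 + a) * y + a * y ^+ 2.

Definition kernel_param (y : R) : R := expR (a * (1 - y)) * (y * kernel_den y).

Let W := xygf z.

(** The equation says that the derivative of [xygf_equation] in $W$ vanishes. Its left side is
    nondecreasing in $y$, positive at 0, and at most $x < 1$ at 1 because $W(x,1) \le 2$. *)
Lemma kernel_root (x : R) : 0 < x < 1 ->
  exists2 y : R, 0 < y < 1 & x / 2 * expR (a * (y - 1)) * W x y = y.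
Proof.
move=> /andP[x0 x1]; have xI : 0 <= x <= 1 by rewrite !ltW.
pose m (t : R) : R := x / 2 * expR (a * (t - 1)) * W x t.
have m_homo t u : 0 <= t -> t <= u -> u <= 1 -> m t <= m u.
  move=> t0 tu u1; have tI : 0 <= t <= 1 by rewrite t0 (le_trans tu).
  rewrite /m ler_pM ?(xygf_ge0 a_ge0 z_law) ?(ler_xygf a_ge0 z_law) //.
    by rewrite mulr_ge0 ?expR_ge0 // divr_ge0 // ltW.
  rewrite ler_wpM2l ?divr_ge0 ?(ltW x0) // ler_expR ler_wpM2l //.
  by rewrite lerD2r.
have m0 : 0 < m 0.
  rewrite /m mulr_gt0 ?mulr_gt0 ?expR_gt0 ?invr_gt0 //.
  by rewrite (lt_le_trans ltr01) // (xygf_ge1 a_ge0 z_law) ?lexx ?ler01.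
have m1 : m 1 < 1.
  rewrite /m subrr mulr0 expR0 mulr1.
  have : W x 1 <= 2 by rewrite (xygf_le2 a_ge0 z_law) ?lexx ?ler01.
  by nra.
exact: (@monotone_fixpoint R m).
Qed.

Lemma kernel_parametrization (x : R) : 0 < x < 1 -> exists y : R,
  [/\ 0 < y < 1, x = kernel_param y &
      W x 0 ^+ 2 * kernel_den y ^+ 2 = 4 * expR (a * y) * (1 - a * y)].
Proof.
move=> /[dup] xx /kernel_root[y /[dup] yy /andP[y0 y1] ey].
have /andP[x0 x1] := xx.
have xI : 0 <= x <= 1 by rewrite !ltW.
pose f0 := x / 4 * expR (- a) * W x 0 ^+ 2.
(* The discriminant of [xygf_equation] as a quadratic in $W$. By [ED] it is a square on $[0,1]$, so
   [y] is an interior minimum, where both [D] and its derivative vanish. *)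
pose D (t : R) : R := t ^+ 2 - x * expR (a * (t - 1)) * (t - (1 - t) * f0).
have ED (t : R) : 0 <= t <= 1 -> D t = (x / 2 * expR (a * (t - 1)) * W x t - t) ^+ 2.
  move=> tI; have h := xygf_equation a_ge0 z_law xI tI; rewrite -/f0 in h.
  rewrite /D; have -> : t - (1 - t) * f0 =
    t * W x t - x / 4 * expR (a * (t - 1)) * W x t ^+ 2.
    by rewrite /W -h; ring.
  by field.
have Dy : D y = 0.
  by rewrite ED ?ey ?subrr ?expr0n // !ltW.
have Dge (t : R) : t \in `]0, 1[ -> D y <= D t.
  rewrite in_itv /= => /andP[t0 t1].
  by rewrite Dy ED ?sqr_ge0 // !ltW.
have dD (t : R) : is_derive t 1 D (2 * t - x * expR (a * (t - 1)) *
    (a * (t - (1 - t) * f0) + 1 + f0)).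
  rewrite /D; apply: is_derive_eq; rewrite /GRing.scale /=; ring.
have D'y : is_derive y 1 D 0.
  by apply: (@derive1_at_min _ _ 0 1); rewrite ?in_itv.
have e2 : 2 * y - x * expR (a * (y - 1)) * (a * (y - (1 - y) * f0) + 1 + f0) = 0.
  by case: (dD y) => _ <-; case: D'y => _ <-.
have e1 : y ^+ 2 - x * expR (a * (y - 1)) * (y - (1 - y) * f0) = 0 by exact: Dy.
set s := expR (a * (y - 1)) in e1 e2.
have es : s * expR (a * (1 - y)) = 1.
  rewrite -expRD; have -> : a * (y - 1) + a * (1 - y) = 0 by ring.
  exact: expR0.
(* The conditions [e1] and [e2] are linear in $xs$ and $xsf_0$. Subtracting [a] times [e1] from [e2]
   gives [eA]; substituting it into [e1] gives [eB], and their difference is [eC]. *)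
have eA : x * s * (1 + f0) = 2 * y - a * y ^+ 2.
  apply: subr0_eq; rewrite -[RHS](subrr 0) -{1}(mulr0 a) -{1}e1 -e2; ring.
have eB : x * s * f0 = y ^+ 2 - a * y ^+ 3.
  apply: subr0_eq; transitivity (y * (x * s * (1 + f0) - (2 * y - a * y ^+ 2))
    + (y ^+ 2 - x * s * (y - (1 - y) * f0))); first by ring.
  by rewrite eA subrr mulr0 add0r.
have eC : x * s = y * kernel_den y.
  rewrite /kernel_den; have -> : x * s = x * s * (1 + f0) - x * s * f0 by ring.
  by rewrite eA eB; ring.
exists y; split=> //.
  by rewrite /kernel_param -eC mulrCA [X in _ * X]mulrC es mulr1.
have ee : s * expR a = expR (a * y).
  by rewrite -expRD; congr expR; ring.
have ea : expR (- a) * expR a = 1 by rewrite -expRD addNr expR0.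
have ns : x * s != 0 by rewrite mulf_neq0 ?gt_eqF ?expR_gt0.
(* After multiplication by the nonzero $xsy^2$, the square of $W(x,0)$ occurs only through [f0],
   which [eB] evaluates. *)
apply: (mulfI ns); apply: (mulfI (lt0r_neq0 y0)); apply: (mulfI (lt0r_neq0 y0)).
transitivity (W x 0 ^+ 2 * (x * s) * (y * kernel_den y) ^+ 2); first by ring.
rewrite -eC -ee.
transitivity (4 * expR a * (x * s * f0) * s * (x * s)).
  rewrite /f0; transitivity (W x 0 ^+ 2 * (x * s) ^+ 3 * (expR (- a) * expR a)).
    by rewrite ea; ring.
  by field.
by rewrite eB; ring.
Qed.

End kernel_method.

Lemma is_derive_cvg_left (R : realType) (f : R -> R) (x df : R) :
  is_derive x 1 f df -> f y @[y --> x^'-] --> f x.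
Proof.
case=> /derivable1_diffP/differentiable_continuous h _.
exact: cvg_at_left_filter.
Qed.

Lemma is_derive_onem (R : realType) (x : R) :
  is_derive x 1 (fun y : R => 1 - y) (- 1).
Proof.
exact: (is_derive_eq (is_deriveB (is_derive_cst (1 : R) x 1)
  (is_derive_id x 1)) (sub0r _)).
Qed.

(** * The parametrization near $y = 1$ *)

Section kernel_near_1.
Context {R : realType} (a : R).

(** The derivative of [kernel_param] without its factors $e^{a(1-y)}$ and $1-y$. At $y = 1$ it is
    $a^2 - 4a + 2$, whose smaller root is the threshold $2 - \sqrt 2$. *)
Definition kernel_curv (y : R) : R := 2 - 4 * (a * y) + (a * y) ^+ 2.

Lemma kernel_den1 : kernel_den a 1 = 1.
Proof. by rewrite /kernel_den; ring. Qed.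

Lemma kernel_param1 : kernel_param a 1 = 1.
Proof. by rewrite /kernel_param kernel_den1 subrr mulr0 expR0 !mul1r. Qed.

Lemma is_derive_kernel_param (y : R) : is_derive y 1 (kernel_param a)
  (expR (a * (1 - y)) * ((1 - y) * kernel_curv y)).
Proof.
rewrite /kernel_param /kernel_den /kernel_curv.
by apply: is_derive_eq; rewrite /GRing.scale /=; ring.
Qed.

(** One application of l'Hopital's rule is enough: the derivatives of numerator and denominator
    share the factor $1 - y$. *)
Lemma kernel_param_quadratic :
  (1 - kernel_param a y) / (1 - y) ^+ 2 @[y --> (1 : R)^'-]
    --> kernel_curv 1 / 2.
Proof.
apply: (@lhopital_at_left R (fun y => 1 - kernel_param a y)
    (fun y => - (expR (a * (1 - y)) * ((1 - y) * kernel_curv y)))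
    (fun y => (1 - y) ^+ 2)
    (fun y => - (2 * (1 - y))) 0 1).
- exact: ltr01.
- move=> y _; have h := is_derive_kernel_param y.
  exact: (is_derive_eq (is_deriveB (is_derive_cst (1 : R) y 1) h) (sub0r _)).
- by move=> y _; apply: is_derive_eq; rewrite /GRing.scale /=; ring.
- have h := is_derive_cvg_left (is_derive_kernel_param 1).
  rewrite kernel_param1 in h; rewrite -[X in _ --> X](subrr (1 : R)).
  by apply: cvgB => //; exact: cvg_cst.
- have h : is_derive (1 : R) 1 (fun y : R => (1 - y) ^+ 2) 0.
    by apply: is_derive_eq; rewrite /GRing.scale /=; ring.
  by have := is_derive_cvg_left h; rewrite subrr expr0n.
- move=> y; rewrite in_itv /= => /andP[_ y1].
  by rewrite oppr_eq0 mulf_neq0 // subr_eq0 gt_eqF.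
have h : is_derive (1 : R) 1 (fun y : R => expR (a * (1 - y)) * kernel_curv y / 2)
    ((- a * kernel_curv 1 - 4 * a + 2 * a ^+ 2) / 2).
  rewrite /kernel_curv; apply: is_derive_eq; rewrite /GRing.scale /=.
  by rewrite subrr mulr0 expR0; field.
have := is_derive_cvg_left h; rewrite subrr mulr0 expR0 mul1r.
apply: cvg_trans; apply: near_eq_cvg.
near=> y; have y1 : 1 - y != 0.
  by rewrite subr_eq0 gt_eqF //; near: y; exact: nbhs_left_lt.
by field.
Unshelve. all: by end_near. Qed.

(** Along the curve this is $(W(1,0)^2 - W(x,0)^2)\,d(y)^2$, once $W(1,0)^2 = 4e^a(1-a)$ is
    known. *)
Definition kernel_num (y : R) : R :=
  4 * expR a * (1 - a) * kernel_den a y ^+ 2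
  - 4 * expR (a * y) * (1 - a * y).

Lemma kernel_num_linear :
  kernel_num y / (1 - y) @[y --> (1 : R)^'-] --> 4 * expR a * kernel_curv 1.
Proof.
apply: (@lhopital_at_left R kernel_num
    (fun y => 8 * expR a * (1 - a) * kernel_den a y * (2 * a * y - (1 + a))
              + 4 * expR (a * y) * (a ^+ 2 * y))
    (fun y => 1 - y) (fun=> - 1) 0 1).
- exact: ltr01.
- move=> y _; rewrite /kernel_num /kernel_den.
  by apply: is_derive_eq; rewrite /GRing.scale /=; ring.
- by move=> y _; exact: is_derive_onem.
- have h : is_derive (1 : R) 1 kernel_num (8 * expR a * (1 - a) * kernel_den a 1 *
      (2 * a * 1 - (1 + a)) + 4 * expR (a * 1) * (a ^+ 2 * 1)).
    rewrite /kernel_num /kernel_den.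
    by apply: is_derive_eq; rewrite /GRing.scale /=; ring.
  have := is_derive_cvg_left h.
  by rewrite {2}/kernel_num kernel_den1 !mulr1 expr1n mulr1 subrr.
- by have := is_derive_cvg_left (is_derive_onem (1 : R)); rewrite subrr.
- by move=> y _; rewrite oppr_eq0 oner_eq0.
pose f (y : R) : R := (8 * expR a * (1 - a) * kernel_den a y
    * (2 * a * y - (1 + a)) + 4 * expR (a * y) * (a ^+ 2 * y)) / - 1.
have [df h] : exists df, is_derive (1 : R) 1 f df.
  by eexists; rewrite /f /kernel_den; exact: is_derive_eq.
have := is_derive_cvg_left h; rewrite /f kernel_den1 /kernel_curv.
suff -> : (8 * expR a * (1 - a) * 1 * (2 * a * 1 - (1 + a)) +
    4 * expR (a * 1) * (a ^+ 2 * 1)) / - 1 =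
   4 * expR a * (2 - 4 * (a * 1) + (a * 1) ^+ 2) by [].
by rewrite !mulr1 invrN1; ring.
Qed.

Hypothesis a_ge0 : 0 <= a.
Hypothesis a_sub : a < 2 - Num.sqrt 2.

Lemma subcritical_lt1 : a < 1.
Proof.
have : 1 < Num.sqrt 2 :> R by rewrite -[ltLHS]sqrtr1 ltr_sqrt ?ltr1n.
by move: a_sub; lra.
Qed.

(** Completing the square gives $(2-ay)^2 - 2$, and $ay \le a < 2 - \sqrt 2$. *)
Lemma kernel_curv_gt0 y : 0 <= y <= 1 -> 0 < kernel_curv y.
Proof.
move=> /andP[y0 y1]; have s0 := sqrtr_ge0 (2 : R).
have s2 : Num.sqrt 2 ^+ 2 = 2 :> R by rewrite sqr_sqrtr.
have h1 : a * y <= a by rewrite ler_piMr.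
have h2 : 0 <= a * y by rewrite mulr_ge0.
rewrite /kernel_curv; move: (a * y) h1 h2 => u h1 h2.
have -> : 2 - 4 * u + u ^+ 2 = (2 - u) ^+ 2 - Num.sqrt 2 ^+ 2.
  by rewrite s2; ring.
by rewrite subr_sqr; apply: mulr_gt0; move: a_sub; lra.
Qed.

Lemma kernel_param_incr y y' : 0 <= y -> y < y' -> y' <= 1 ->
  kernel_param a y < kernel_param a y'.
Proof.
apply: gtr0_derive1_incr => [t _|t|].
- by case: (is_derive_kernel_param t).
- rewrite in_itv /= => /andP[t0 t1]; rewrite derive1E.
  case: (is_derive_kernel_param t) => _ ->.
  by rewrite !mulr_gt0 ?expR_gt0 ?kernel_curv_gt0 ?subr_gt0 // !ltW.
apply: derivable_within_continuous => t _.
by case: (is_derive_kernel_param t).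
Qed.

Lemma kernel_param_itv y : 0 < y < 1 -> 0 < kernel_param a y < 1.
Proof.
move=> /andP[y0 y1]; have := kernel_param_incr (lexx 0) y0 (ltW y1).
rewrite {1}/kernel_param mul0r mulr0 => -> /=.
by rewrite -kernel_param1 kernel_param_incr // ltW.
Qed.

Lemma kernel_param_inj y y' : 0 < y < 1 -> 0 < y' < 1 ->
  kernel_param a y = kernel_param a y' -> y = y'.
Proof.
move=> /andP[y0 y1] /andP[y'0 y'1] e; apply/eqP; rewrite eq_le !leNgt.
apply/andP; split; apply/negP => h.
  by have := kernel_param_incr (ltW y'0) h (ltW y1); rewrite e ltxx.
by have := kernel_param_incr (ltW y0) h (ltW y'1); rewrite e ltxx.
Qed.

End kernel_near_1.

(** * The limit with Poisson arrivals *)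

Lemma onem_exp_le (R : realDomainType) (x : R) n : 0 <= x <= 1 ->
  0 <= 1 - x ^+ n <= n%:R * (1 - x).
Proof.
move=> /andP[x0 x1]; elim: n => [|n /andP[h0 h1]].
  by rewrite expr0 subrr mul0r lexx.
have p0 : 0 <= x ^+ n by rewrite exprn_ge0.
rewrite exprSr -natr1 subr_ge0; apply/andP; split.
  by rewrite mulr_ile1 // ?exprn_ge0 // -subr_ge0.
have -> : 1 - x ^+ n * x = (1 - x ^+ n) + x ^+ n * (1 - x) by ring.
by rewrite mulrDl mul1r lerD // ler_piMl ?subr_ge0 // -subr_ge0.
Qed.

Lemma sums_finite (R : realType) (f : nat -> R) N :
  (forall n, (N <= n)%N -> f n = 0) -> sums f (\sum_(n < N) f n).
Proof.
elim: N f => [|N IH] f f0; first by rewrite big_ord0; apply: sums0 => n; apply: f0.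
rewrite big_ord_recl; apply/(sums_behead f); apply: IH => n Nn.
exact: f0.
Qed.

(** The terms $(u_n - l c_n)(1 - x^n)$ are compared one by one: for $n < N$ Bernoulli's inequality
    bounds them by a constant times $1 - x$, for $n \ge N$ they are at most [eps] times
    $c_n(1-x^n)$. As [K] does not depend on [x], its term is negligible when [C1 - Cx] is of order
    $\sqrt{1-x}$. *)
Lemma abelian_gap (R : realType) (u c : nat -> R) (l eps : R) (N : nat) :
  (forall n, 0 <= c n) -> (forall n, l * c n <= u n) -> 0 <= eps ->
  (forall n, (N <= n)%N -> u n <= (l + eps) * c n) ->
  exists2 K, 0 <= K & forall x U1 Ux C1 Cx, 0 <= x <= 1 ->
    sums u U1 -> sums (fun n => u n * x ^+ n) Ux ->
    sums c C1 -> sums (fun n => c n * x ^+ n) Cx ->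
    0 <= U1 - Ux - l * (C1 - Cx) <= eps * (C1 - Cx) + K * (1 - x).
Proof.
move=> c0 lu eps0 uN; pose k n := if (n < N)%N then (u n - l * c n) * n%:R else 0.
have k0 n : 0 <= k n.
  by rewrite /k; case: ifP => // _; rewrite mulr_ge0 // subr_ge0.
have kN n : (N <= n)%N -> k n = 0 by rewrite /k ltnNge => ->.
exists (\sum_(n < N) k n) => [|x U1 Ux C1 Cx xI hU1 hUx hC1 hCx].
  exact: sumr_ge0.
have hv : sums (fun n => (u n - l * c n) * (1 - x ^+ n))
               (U1 - Ux - l * (C1 - Cx)).
  have -> : U1 - Ux - l * (C1 - Cx) =
    U1 + (- 1 * Ux + (- l * C1 + l * Cx)) by ring.
  apply: (eq_sums _ (sumsD hU1 (sumsD (sumsZ (- 1) hUx)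
    (sumsD (sumsZ (- l) hC1) (sumsZ l hCx))))) => n; ring.
have hw : sums (fun n => eps * (c n * (1 - x ^+ n)) + (1 - x) * k n)
    (eps * (C1 - Cx) + (\sum_(n < N) k n) * (1 - x)).
  rewrite [(\sum_(n < N) k n) * _]mulrC.
  apply: sumsD; apply: sumsZ; last exact: sums_finite.
  have -> : C1 - Cx = C1 + - 1 * Cx by ring.
  by apply: (eq_sums _ (sumsD hC1 (sumsZ (- 1) hCx))) => n; ring.
have x1 : 0 <= 1 - x by case/andP: xI => _; rewrite subr_ge0.
have v0 n : 0 <= (u n - l * c n) * (1 - x ^+ n).
  by have /andP[? _] := onem_exp_le n xI; rewrite mulr_ge0 // subr_ge0.
apply/andP; split; first exact: sums_ge0 hv.
apply: ler_sums hv hw => n.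
  have /andP[? _] := onem_exp_le n xI.
  by rewrite addr_ge0 // mulr_ge0 // mulr_ge0.
have /andP[h0 h1] := onem_exp_le n xI.
have [nN|Nn] := ltnP n N.
  rewrite ler_wpDl //; first by rewrite mulr_ge0 // mulr_ge0.
  by rewrite /k nN mulrCA ler_wpM2l // ?subr_ge0 // mulrC.
rewrite kN // mulr0 addr0 mulrA ler_wpM2r //.
by rewrite lerBlDl -mulrDl uN.
Qed.

Section limit_identification.
Context {R : realType} (a : R) (z : nat -> nat -> R).
Hypothesis a_ge0 : 0 <= a.
Hypothesis a_sub : a < 2 - Num.sqrt 2.
Hypothesis z_law : overflow_law 4^-1 (poisson_wt a) z.

Let W := xygf z.
Let c : nat -> R := catalan4.
Let c_gt0 n : 0 < c n. Proof. exact: catalan4_gt0. Qed.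

Lemma cumul_poisson_wt_le1 n : cumul (poisson_wt a) n <= 1.
Proof.
have := sums_poisson_wt a 1; rewrite subrr mulr0 expR0 => h.
have -> : cumul (poisson_wt a) = cumul (fun i => poisson_wt a i * 1 ^+ i).
  by congr cumul; apply/funext => i; rewrite expr1n mulr1.
by apply: cumul_le_sums => // i; rewrite expr1n mulr1 poisson_wt_ge0.
Qed.

Lemma park_prob_nonincreasing :
  {homo (fun n => z n 0%N / c n) : n m / (n <= m)%N >-> m <= n}.
Proof.
apply: (@homo_leq _ _ (fun x y : R => y <= x)) => [//| m n p|n].
  by move=> h1 h2; exact: le_trans h2 h1.
have := overflow_law_nonincreasing (poisson_wt_ge0 a_ge0) cumul_poisson_wt_le1
  z_law n 0.
by rewrite /cumul !big_ord1.
Qed.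

Lemma park_prob_cvg : cvgn (fun n => z n 0%N / c n).
Proof.
apply: nonincreasing_is_cvgn; first exact: park_prob_nonincreasing.
exists 0 => _ [n _ <-]; rewrite divr_ge0 ?(ltW (c_gt0 n)) //.
exact: overflow_law_ge0 (poisson_wt_ge0 a_ge0) z_law _ _.
Qed.

(** The Catalan generating function. The bound $W \le 2$ makes $1 - xW/2$ nonnegative and thereby
    selects the branch of the quadratic. *)
Lemma xygf_at1 x : 0 < x <= 1 -> (1 + Num.sqrt (1 - x)) * W x 1 = 2.
Proof.
move=> /andP[x0 x1]; have xI : 0 <= x <= 1 by rewrite ltW.
have I1 : 0 <= (1 : R) <= 1 by rewrite ler01 lexx.
have := xygf_equation a_ge0 z_law xI I1.
have := xygf_le2 a_ge0 z_law xI I1.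
rewrite -/W subrr mulr0 expR0 mul1r mul0r addr0 mulr1; move: (W x 1) => w w2 e.
have s0 : 0 <= 1 - x by rewrite subr_ge0.
set s := Num.sqrt (1 - x); have ss : s ^+ 2 = 1 - x by rewrite sqr_sqrtr.
have e1 : 1 - x / 2 * w = s.
  apply/eqP; rewrite -(eqrXn2 (n := 2)) ?sqrtr_ge0 //; last by nra.
  rewrite ss; apply/eqP.
  transitivity (1 - x + x * (1 + x / 4 * w ^+ 2 - w)); first by field.
  by rewrite -e; ring.
have e2 : (1 - s) * ((1 + s) * w) = (1 - s) * 2.
  transitivity ((1 - s ^+ 2) * w); first by ring.
  by rewrite ss -e1; field.
apply: (mulfI _ e2); rewrite subr_eq0 gt_eqF //.
by rewrite -[ltRHS]sqrtr1 ltr_sqrt // ltrBlDr ltrDl.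
Qed.

Lemma sums_no_car_lost x : 0 <= x <= 1 ->
  sums (fun n => z n 0%N * x ^+ n) (W x 0).
Proof.
move=> xI; have I0 : 0 <= (0 : R) <= 1 by rewrite ler01 lexx.
apply: (eq_sums _ (sums_xygf a_ge0 z_law xI I0)) => n.
by rewrite (ygf_at0 a_ge0 z_law).
Qed.

Lemma sums_catalan4 x : 0 <= x <= 1 -> sums (fun n => c n * x ^+ n) (W x 1).
Proof.
move=> xI; have I1 : 0 <= (1 : R) <= 1 by rewrite ler01 lexx.
apply: (eq_sums _ (sums_xygf a_ge0 z_law xI I1)) => n.
by rewrite (ygf1 a_ge0 z_law).
Qed.

Lemma sums_at1 (f : nat -> R) S : sums (fun n => f n * 1 ^+ n) S -> sums f S.
Proof. by apply: eq_sums => n; rewrite expr1n mulr1. Qed.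

(** This is [abelian_gap] comparing $W(\cdot,0)$ with $W(\cdot,1)$. Since the ratios decrease to
    [l], all of them are at least [l], as required there. *)
Lemma singular_gap (l eps : R) : z n 0%N / c n @[n --> \oo] --> l -> 0 < eps ->
  exists2 K, 0 <= K & forall x, 0 < x <= 1 ->
    0 <= W 1 0 - W x 0 - l * (2 - W x 1) <= eps * (2 - W x 1) + K * (1 - x).
Proof.
move=> ql eps0.
have lu n : l * c n <= z n 0%N.
  rewrite -ler_pdivlMr // -(cvg_lim (@norm_hausdorff _ _) ql).
  apply: nonincreasing_cvgn_ge; first exact: park_prob_nonincreasing.
  exact: park_prob_cvg.
have [N _ hN] : \forall n \near \oo, `|l - z n 0%N / c n| <= eps.
  by move/cvgrPdist_le: ql; apply.
have uN n : (N <= n)%N -> z n 0%N <= (l + eps) * c n.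
  move=> /hN /=; rewrite distrC => /ler_normlW.
  by rewrite lerBlDl addrC ler_pdivrMr.
have [K K0 hK] := abelian_gap (fun n => ltW (c_gt0 n)) lu (ltW eps0) uN.
exists K => // x /[dup] xx /andP[x0 x1].
have xI : 0 <= x <= 1 by rewrite ltW.
have I1 : 0 <= (1 : R) <= 1 by rewrite ler01 lexx.
have W11 : W 1 1 = 2.
  have := @xygf_at1 1; rewrite ltr01 lexx => /(_ isT).
  by rewrite subrr sqrtr0 addr0 mul1r.
rewrite -W11; apply: hK => //.
- exact: sums_at1 (sums_no_car_lost I1).
- exact: sums_no_car_lost.
- exact: sums_at1 (sums_catalan4 I1).
- exact: sums_catalan4.
Qed.

End limit_identification.

(** * The value of the limit: comparison of the singularities at $x = 1$ *)

Section limit_value.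
Context {R : realType} (a : R) (z : nat -> nat -> R).
Hypothesis a_ge0 : 0 <= a.
Hypothesis a_sub : a < 2 - Num.sqrt 2.
Hypothesis z_law : overflow_law 4^-1 (poisson_wt a) z.

Let W := xygf z.
(** Everything is written along the curve $x = g(y)$ as $y$ increases to 1: [s] is $\sqrt{1-x}$, [B]
    is $W(x,0)$, and [rho] is the ratio of the increments of $W(\cdot,0)$ and $W(\cdot,1)$ between
    $x$ and 1. *)
Let g := kernel_param a.
Let s y := Num.sqrt (1 - g y).
Let B y := W (g y) 0.
Let gap y := 2 - W (g y) 1.
Let rho y := (W 1 0 - B y) / gap y.

Let near_itv01 : \forall y \near (1 : R)^'-, 0 < y < 1.
Proof.
near=> y; apply/andP; split; near: y; last exact: nbhs_left_lt.
by apply: nbhs_left_gt; exact: ltr01.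
Unshelve. all: by end_near. Qed.

Let s_gt0 y : 0 < y < 1 -> 0 < s y.
Proof.
move=> /(kernel_param_itv a_ge0 a_sub) /andP[_ g1].
by rewrite sqrtr_gt0 subr_gt0.
Qed.

Let s_sqr y : 0 < y < 1 -> s y ^+ 2 = 1 - g y.
Proof.
move=> /(kernel_param_itv a_ge0 a_sub) /andP[_ g1].
by rewrite sqr_sqrtr // subr_ge0 ltW.
Qed.

Let gapE y : 0 < y < 1 -> gap y = 2 * s y / (1 + s y).
Proof.
move=> yI; have s0 := s_gt0 yI.
have /andP[g0 g1] := kernel_param_itv a_ge0 a_sub yI.
have := @xygf_at1 R a z a_ge0 z_law (g y).
rewrite g0 ltW // => /(_ isT); rewrite -/(s y) -/W /gap.
move: (W _ _) (s y) s0 => w t t0 e; have t1 : 1 + t != 0 by rewrite gt_eqF; lra.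
have -> : w = 2 / (1 + t) by rewrite -e mulrC mulKf.
by field.
Qed.

(** The kernel method only provides some [y'] with $g(y') = g(y)$; strict monotonicity of [g]
    identifies it with [y]. *)
Let kernel_sqr y : 0 < y < 1 ->
  B y ^+ 2 * kernel_den a y ^+ 2 = 4 * expR (a * y) * (1 - a * y).
Proof.
move=> yI.
have [y' [y'I e h]] := kernel_parametrization a_ge0 z_law
  (kernel_param_itv a_ge0 a_sub yI).
by rewrite -(kernel_param_inj a_ge0 a_sub yI y'I e) in h.
Qed.

Let kernel_den_cvg : kernel_den a y @[y --> (1 : R)^'-] --> (1 : R).
Proof.
have [df h] : exists df, is_derive (1 : R) 1 (kernel_den a) df.
  by eexists; rewrite /kernel_den; exact: is_derive_eq.
by have := is_derive_cvg_left h; rewrite kernel_den1.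
Qed.

Let s_cvg : s y @[y --> (1 : R)^'-] --> (0 : R).
Proof.
have h : 1 - g y @[y --> (1 : R)^'-] --> (0 : R).
  have := is_derive_cvg_left (is_derive_kernel_param a 1).
  rewrite kernel_param1 => h; rewrite -[X in _ --> X](subrr (1 : R)).
  by apply: cvgB => //; exact: cvg_cst.
by have := cvg_comp _ _ h (@sqrt_continuous R 0); rewrite sqrtr0.
Qed.

Let gap_cvg : gap y @[y --> (1 : R)^'-] --> (0 : R).
Proof.
have h : 2 * s y / (1 + s y) @[y --> (1 : R)^'-] --> (2 * 0 / (1 + 0) : R).
  apply: cvgM; first by apply: cvgM => //; exact: cvg_cst.
  apply: cvgV; first by rewrite addr0 oner_neq0.
  by apply: cvgD => //; exact: cvg_cst.
rewrite mulr0 mul0r in h; apply: cvg_trans h; apply: near_eq_cvg.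
by near=> y; rewrite gapE //; near: y; exact: near_itv01.
Unshelve. all: by end_near. Qed.

Variable l : R.
Hypothesis ql : z n 0%N / catalan4 n @[n --> \oo] --> l.

Let rho_cvg : rho y @[y --> (1 : R)^'-] --> l.
Proof.
(* Here [t] stands for $s = \sqrt{1-x}$: the error $K(1-x) = Ks^2$ is dominated by the gap
   $2s/(1+s)$ as soon as $Ks$ is small. *)
have aux (K e t : R) : 0 < e -> 0 < t -> t <= 1 -> K * t <= e ->
    K * t ^+ 2 * (1 + t) <= e * (2 * t).
  move=> e0 t0 t1 kt; have h3 : 0 <= (e - K * t) * (t * (1 + t)).
    by rewrite mulr_ge0 ?subr_ge0 // mulr_ge0; lra.
  have h4 : 0 <= e * (t * (1 - t)).
    by rewrite mulr_ge0 ?mulr_ge0 ?subr_ge0 // ltW.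
  by move: h3 h4; nra.
apply/cvgrPdist_le => eps eps0.
have e2 : 0 < eps / 2 by rewrite divr_gt0.
have [K K0 hK] := singular_gap a_ge0 z_law ql e2.
have Ks : K * s y @[y --> (1 : R)^'-] --> K * 0.
  by apply: cvgM => //; exact: cvg_cst.
rewrite mulr0 in Ks.
near=> y.
have yI : 0 < y < 1 by near: y; exact: near_itv01.
have /andP[g0 g1] := kernel_param_itv a_ge0 a_sub yI.
have s0 := s_gt0 yI; have ss := s_sqr yI.
have s1 : s y <= 1 by rewrite -[leRHS]sqrtr1 ler_sqrt // lerBlDr lerDl ltW.
have Kse : K * s y <= eps / 2.
  have : `|0 - K * s y| <= eps / 2 by near: y; move/cvgrPdist_le: Ks; apply.
  by rewrite sub0r normrN ger0_norm // mulr_ge0 // ltW.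
have gp : 0 < gap y by rewrite gapE // divr_gt0 ?mulr_gt0 // addr_gt0.
have /andP[h1 h2] : 0 <= W 1 0 - B y - l * gap y <= eps / 2 * gap y + K * (1 - g y).
  by apply: hK; rewrite g0 ltW.
have h3 : K * (1 - g y) <= eps / 2 * gap y.
  rewrite -ss gapE // [leRHS]mulrA ler_pdivlMr; last by rewrite addr_gt0.
  exact: aux.
rewrite distrC.
have -> : rho y - l = (W 1 0 - B y - l * gap y) / gap y.
  by rewrite /rho; field; rewrite gt_eqF.
rewrite ger0_norm; last by rewrite divr_ge0 // ltW.
rewrite ler_pdivrMr //; move: h2 h3.
by move: (gap y) (K * _) (W 1 0 - _ - _) => G k V; lra.
Unshelve. all: by end_near. Qed.

(** Continuity of $W(\cdot,0)$ at 1 along the curve: the increment is [rho * gap], where [rho]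
    converges and [gap] tends to 0. *)
Let B_cvg : B y @[y --> (1 : R)^'-] --> W 1 0.
Proof.
have h : W 1 0 - rho y * gap y @[y --> (1 : R)^'-] --> W 1 0 - l * 0.
  by apply: cvgB; [exact: cvg_cst | exact: cvgM].
rewrite mulr0 subr0 in h; apply: cvg_trans h; apply: near_eq_cvg.
near=> y; have yI : 0 < y < 1 by near: y; exact: near_itv01.
have gp : 0 < gap y by rewrite gapE // divr_gt0 ?mulr_gt0 ?addr_gt0 ?s_gt0.
by rewrite /rho; field; rewrite gt_eqF.
Unshelve. all: by end_near. Qed.

Let B1_sqr : W 1 0 ^+ 2 = 4 * expR a * (1 - a).
Proof.
have h1 : (B y * B y) * (kernel_den a y * kernel_den a y) @[y --> (1 : R)^'-]
    --> W 1 0 * W 1 0 * (1 * 1).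
  by apply: cvgM; apply: cvgM.
have [df h] : exists df, is_derive (1 : R) 1
    (fun y => 4 * expR (a * y) * (1 - a * y)) df.
  by eexists; exact: is_derive_eq.
have := is_derive_cvg_left h; rewrite !mulr1 => h2.
rewrite expr2 -[W 1 0 * _]mulr1 -{3}[1]mulr1.
apply: cvg_unique h1 _ => //; apply: cvg_trans h2; apply: near_eq_cvg.
near=> y; rewrite -kernel_sqr ?expr2 //; near: y; exact: near_itv01.
Unshelve. all: by end_near. Qed.

Lemma park_prob_limit :
  l = expR (a / 2) * Num.sqrt ((a ^+ 2 - 4 * a + 2) / (2 * (1 - a))).
Proof.
have a1 : a < 1 := subcritical_lt1 a_sub.
have k1 : 0 < kernel_curv a 1 by rewrite kernel_curv_gt0 // ler01 lexx.
have W0 : 1 <= W 1 0 by apply: (xygf_ge1 a_ge0 z_law); rewrite ler01 lexx.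
have l0 : 0 <= l.
  rewrite -(cvg_lim (@norm_hausdorff _ _) ql); apply: limr_ge.
    exact: cvgP ql.
  apply: nearW => n; rewrite divr_ge0 ?(ltW (catalan4_gt0 _)) //.
  exact: overflow_law_ge0 (poisson_wt_ge0 a_ge0) z_law _ _.
have ek : kernel_curv a 1 = a ^+ 2 - 4 * a + 2 by rewrite /kernel_curv; ring.
have lsq : l ^+ 2 = expR a * kernel_curv a 1 / (2 * (1 - a)).
  have h1 : rho y * rho y @[y --> (1 : R)^'-] --> l * l by exact: cvgM.
  (* The factorization $\rho^2 = X^2 Q$. Squaring turns the $s$ in the denominator into $1 - x$, to
     which [kernel_param_quadratic] applies; [l0] later selects the root. *)
  pose X (y : R) : R := kernel_num a y / (1 - y) / (kernel_den a y * kernel_den a y *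
      (W 1 0 + B y)) * ((1 + s y) / 2).
  pose Q (y : R) : R := ((1 - g y) / (1 - y) ^+ 2)^-1.
  have hX : X y @[y --> (1 : R)^'-] -->
      4 * expR a * kernel_curv a 1 / (1 * 1 * (W 1 0 + W 1 0)) * ((1 + 0) / 2).
    apply: cvgM; last first.
      by apply: cvgM; [apply: cvgD => // | ]; exact: cvg_cst.
    apply: cvgM; first exact: kernel_num_linear.
    apply: cvgV; first by rewrite !mul1r gt_eqF //; lra.
    apply: cvgM; first exact: cvgM.
    by apply: cvgD => //; exact: cvg_cst.
  have hQ : Q y @[y --> (1 : R)^'-] --> (kernel_curv a 1 / 2)^-1.
    apply: cvgV; first by rewrite gt_eqF // divr_gt0.
    exact: kernel_param_quadratic.
  set X1 := (X in _ --> X) in hX; set Q1 := (X in _ --> X) in hQ.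
  have h2 : X y * X y * Q y @[y --> (1 : R)^'-] --> X1 * X1 * Q1.
    by apply: cvgM => //; exact: cvgM.
  have -> : expR a * kernel_curv a 1 / (2 * (1 - a)) = X1 * X1 * Q1.
    rewrite /X1 /Q1.
    transitivity (2 * expR a ^+ 2 * kernel_curv a 1 / W 1 0 ^+ 2).
      rewrite B1_sqr; have := expR_gt0 a; move: (expR a) => E E0.
      by field; rewrite !gt_eqF // ?subr_gt0.
    by field; rewrite !gt_eqF //; lra.
  rewrite expr2; apply: cvg_unique h1 _ => //.
  apply: cvg_trans h2; apply: near_eq_cvg.
  near=> y; have yI : 0 < y < 1 by near: y; exact: near_itv01.
  have /andP[g0 g1] := kernel_param_itv a_ge0 a_sub yI.
  have s0 := s_gt0 yI.
  have d0 : kernel_den a y != 0.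
    apply/negP => /eqP e; have := g0; rewrite /kernel_param e !mulr0 ltxx //.
  have By : 1 <= B y.
    by apply: (xygf_ge1 a_ge0 z_law); rewrite ?ler01 ?lexx // !ltW.
  have eN : kernel_num a y = (W 1 0 ^+ 2 - B y ^+ 2) * kernel_den a y ^+ 2.
    by rewrite /kernel_num mulrBl (kernel_sqr yI) B1_sqr.
  rewrite /= /X /Q /rho gapE // eN -(s_sqr yI).
  have y1 : 1 - y != 0 by case/andP: yI => _ ?; rewrite subr_eq0 gt_eqF.
  move: (s y) s0 (W 1 0) W0 (B y) By (kernel_den a y) d0 => t t0 w w1 b b1 d d0.
  by field; rewrite y1 d0 !gt_eqF //; lra.
apply/eqP; rewrite -(eqrXn2 (n := 2)) ?mulr_ge0 ?expR_ge0 ?sqrtr_ge0 //.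
rewrite exprMn sqr_sqrtr; last first.
  by rewrite -ek divr_ge0 ?(ltW k1) // mulr_ge0 // subr_ge0 ltW.
rewrite lsq -ek mulrA expr2 -expRD; apply/eqP.
by have -> : a / 2 + a / 2 = a by field.
Unshelve. all: by end_near. Qed.

End limit_value.

(** * Parking on a tree *)

Definition lost (occ s : seq vertex) : nat :=
  count (fun o => ~~ isSome o) (parking occ s).

(** The cars, or the occupied vertices, in the subtree of the [i]-th child, readdressed from the
    root of that subtree. *)
Definition child_part (i : nat) (s : seq vertex) : seq vertex :=
  pmap (fun v => if v is j :: u then if j == i then Some u else None else None) s.

Lemma all_cars_park_lost s : all_cars_park s = (lost [::] s == 0)%N.
Proof.
rewrite /all_cars_park /lost eqn0Ngt -has_count -all_predC.
by apply: eq_all => o /=; rewrite negbK.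
Qed.

Lemma mem_child_part i u s : (u \in child_part i s) = (i :: u \in s).
Proof.
elim: s => //= -[|j v] s IH; first by rewrite /= IH.
rewrite /= in_cons eqseq_cons; case: (eqVneq j i) => [_|_] /=.
  by rewrite in_cons IH.
by rewrite IH.
Qed.

Lemma path_to_root_cons j v :
  path_to_root (j :: v) = rcons [seq j :: u | u <- path_to_root v] [::].
Proof.
have -> : path_to_root (j :: v) =
    [seq take k (j :: v) | k <- rev (0%N :: map S (iota 0 (size v).+1))].
  by rewrite -(iotaDl 1).
by rewrite rev_cons map_rcons -map_rev -!map_comp.
Qed.

Lemma parking_place_nil occ :
  parking_place occ [::] = if [::] \in occ then None else Some [::].
Proof. by rewrite /parking_place /=; case: (_ \in _). Qed.

Lemma parking_place_cons occ j v : parking_place occ (j :: v) =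
  if parking_place (child_part j occ) v is Some u then Some (j :: u)
  else parking_place occ [::].
Proof.
rewrite parking_place_nil /parking_place path_to_root_cons filter_rcons.
rewrite filter_map /=.
rewrite (eq_filter (a2 := fun u => u \notin child_part j occ)); last first.
  by move=> u /=; rewrite mem_child_part.
by case: [seq _ <- _ | _] => [|u l] /=; case: (_ \in occ).
Qed.

Lemma lost_cons occ v s : lost occ (v :: s) =
  if parking_place occ v is Some u then lost (u :: occ) s
  else (lost occ s).+1.
Proof. by rewrite /lost /=; case: (parking_place occ v). Qed.

Definition child_lt K (v : vertex) := if v is i :: _ then (i < K)%N else true.

(** Cars below different children do not interact, and a free root absorbs one of the cars that
    reach it, in whatever order they come. The subtraction truncates when no car reaches a free
    root. *)
Lemma lost_rec K occ s : all (child_lt K) s ->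
  lost occ s = (count_mem [::] s +
    \sum_(i < K) lost (child_part i occ) (child_part i s) - ([::] \notin occ))%N.
Proof.
elim: s occ => [|v s IH] occ; first by rewrite big1.
case: v => [|j v] /= => [sK|/andP[jK sK]].
  rewrite lost_cons parking_place_nil; case: ifP => occ0 /=.
    by rewrite IH // occ0 /= !subn0.
  rewrite IH // in_cons eqxx /= subn0 -addnA addKn; congr (_ + _)%N.
rewrite lost_cons parking_place_cons.
rewrite (bigD1 (Ordinal jK)) //= eqxx lost_cons.
case: (parking_place _ v) => [u|].
  rewrite IH // in_cons /= (bigD1 (Ordinal jK)) //= eqxx.
  congr (_ + (_ + _) - _)%N; apply: eq_bigr => i.
  by rewrite -val_eqE /= eq_sym => /negbTE ->.
rewrite parking_place_nil; case: ifP => occ0 /=.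
  rewrite IH // occ0 /= !subn0 (bigD1 (Ordinal jK)) //=.
  rewrite addSn addnS; congr (_ + (_ + _)).+1; apply: eq_bigr => i.
  by rewrite -val_eqE /= eq_sym => /negbTE ->.
rewrite IH // in_cons eqxx /= subn0 (bigD1 (Ordinal jK)) //=.
rewrite addSn addnS subn1 /=; congr (_ + (_ + _))%N; apply: eq_bigr => i.
by rewrite -val_eqE /= eq_sym => /negbTE ->.
Qed.

Lemma parking_rcons occ s v :
  exists o, parking occ (rcons s v) = rcons (parking occ s) o.
Proof.
elim: s occ => [|u s IH] occ /=; first by eexists.
set occ' := (X in parking X _); have [w ->] := IH occ'; by exists w.
Qed.

Lemma all_cars_park_rcons s v : all_cars_park (rcons s v) -> all_cars_park s.
Proof.
rewrite /all_cars_park; have [w ->] := parking_rcons [::] s v.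
by rewrite all_rcons => /andP[].
Qed.

(** * Words of arrival vertices *)

Section sequences_of_arrivals.
Context {T : eqType}.

(** Words grow at the right end, so the letter split off is the last car to arrive. *)
Fixpoint words (m : nat) (V : seq T) : seq (seq T) :=
  if m is m'.+1 then [seq rcons s v | s <- words m' V, v <- V] else [:: [::]].

Lemma mem_words m V s : (s \in words m V) = (size s == m) && all [in V] s.
Proof.
elim: m s => [|m IH] s /=; first by case: s.
apply/allpairsP/andP => [[[u v] /= [us vV ->]]|[sm sV]].
  move: us; rewrite IH => /andP[/eqP <- uV].
  by rewrite size_rcons all_rcons vV uV.
case/lastP: s sm sV => // u v; rewrite size_rcons eqSS all_rcons => um /andP[vV uV].
by exists (u, v); rewrite IH um uV.
Qed.

Lemma words_uniq m V : uniq V -> uniq (words m V).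
Proof.
move=> uV; elim: m => //= m IH; apply: allpairs_uniq => // -[s v] [s' v'] _ _ /=.
by move=> /rcons_inj[-> ->].
Qed.

Lemma size_words m V : size (words m V) = (size V ^ m)%N.
Proof. by elim: m => //= m IH; rewrite size_allpairs IH expnSr. Qed.

Lemma big_wordsS (A : nmodType) m V (f : seq T -> A) :
  \sum_(s <- words m.+1 V) f s
  = \sum_(v <- V) \sum_(s <- words m V) f (rcons s v).
Proof. by rewrite /= big_allpairs_dep exchange_big. Qed.

End sequences_of_arrivals.

Lemma words_map (T U : eqType) (h : T -> U) m V :
  words m (map h V) = map (map h) (words m V).
Proof.
elim: m => //= m ->; rewrite allpairs_mapl allpairs_mapr map_allpairs.
by apply: eq_allpairs => s v; rewrite map_rcons.
Qed.

(** * Exponential generating functions of sets of words *)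

Section exponential_generating_functions.
Context {R : realType}.

Definition egf (T : eqType) (V : seq T) (f : seq T -> R) (m : nat) : R :=
  (\sum_(s <- words m V) f s) / m`!%:R.

Lemma egfS (T : eqType) (V : seq T) f m :
  m.+1%:R * egf V f m.+1 = \sum_(v <- V) egf V (fun s => f (rcons s v)) m.
Proof.
by rewrite /egf big_wordsS -mulr_suml factS natrM invfM mulrCA mulVKf.
Qed.

Lemma convn_leibniz (f g : nat -> R) m : m.+1%:R * convn f g m.+1 =
  convn (fun i => i.+1%:R * f i.+1) g m + convn f (fun i => i.+1%:R * g i.+1) m.
Proof.
have -> : m.+1%:R * convn f g m.+1 =
    \sum_(i < m.+2) i%:R * f i * g (m.+1 - i)%N +
    \sum_(i < m.+2) f i * ((m.+1 - i)%:R * g (m.+1 - i)%N).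
  rewrite /convn mulr_sumr -big_split; apply: eq_bigr => i _ /=.
  by rewrite natrB -1?ltnS //; ring.
rewrite big_ord_recl mul0r mul0r add0r; congr (_ + _).
rewrite big_ord_recr /= subnn mul0r mulr0 addr0; apply: eq_bigr => i _.
by rewrite subSn // -ltnS.
Qed.

(** A word over [A ++ B] is a shuffle of a word over [A] and one over [B], and the factorials absorb
    the number of shuffles. The induction removes the last letter: [egfS] acts as differentiation
    and [convn_leibniz] as the product rule. *)
Lemma egf_cat (T : eqType) (A B : seq T) (a : pred T) f1 f2 m :
  all a A -> all (predC a) B ->
  egf (A ++ B) (fun s => f1 (seq.filter a s) * f2 (seq.filter (predC a) s)) m
  = convn (egf A f1) (egf B f2) m.
Proof.
move=> aA aB; elim: m f1 f2 => [|m IH] f1 f2.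
  by rewrite /egf /convn big_ord1 /= !big_seq1 fact0 invr1 !mulr1.
apply: (@mulfI _ m.+1%:R); first by rewrite pnatr_eq0.
rewrite egfS convn_leibniz big_cat /=; congr (_ + _).
  rewrite [RHS](_ : _ = convn (fun i => \sum_(v <- A)
      egf A (fun s => f1 (rcons s v)) i) (egf B f2) m); last first.
    by apply: eq_bigr => i _; rewrite egfS.
  rewrite /convn; under [RHS]eq_bigr do rewrite mulr_suml.
  rewrite exchange_big; apply: eq_big_seq => v vA.
  rewrite -[RHS]/(convn _ _ m) -(IH (fun s => f1 (rcons s v))) /egf.
  congr (_ / _); apply: eq_bigr => s _.
  by rewrite !filter_rcons /= (allP aA v vA).
rewrite [RHS](_ : _ = convn (egf A f1) (fun i => \sum_(v <- B)
    egf B (fun s => f2 (rcons s v)) i) m); last first.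
  by apply: eq_bigr => i _; rewrite egfS.
rewrite /convn; under [RHS]eq_bigr do rewrite mulr_sumr.
rewrite exchange_big; apply: eq_big_seq => v vB.
rewrite -[RHS]/(convn _ _ m) -(IH f1 (fun s => f2 (rcons s v))) /egf.
congr (_ / _); apply: eq_bigr => s _.
by rewrite !filter_rcons /= (negbTE (allP aB v vB)).
Qed.

Lemma egf_map (T U : eqType) (h : T -> U) V f m :
  egf (map h V) f m = egf V (f \o map h) m.
Proof. by rewrite /egf words_map big_map. Qed.

Lemma eq_egf (T : eqType) (V : seq T) f g m :
  (forall s, all [in V] s -> f s = g s) -> egf V f m = egf V g m.
Proof.
move=> fg; rewrite /egf; congr (_ / _); apply: eq_big_seq => s.
by rewrite mem_words => /andP[_ /fg].
Qed.

Lemma egf_sum (T : eqType) (V : seq T) n (F : nat -> seq T -> R) m :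
  egf V (fun s => \sum_(i < n) F i s) m = \sum_(i < n) egf V (F i) m.
Proof. by rewrite /egf exchange_big -mulr_suml. Qed.

Lemma egf_ge0 (T : eqType) (V : seq T) f m :
  (forall s, 0 <= f s) -> 0 <= egf V f m.
Proof. by move=> f0; rewrite divr_ge0 // sumr_ge0. Qed.

Lemma indicator_addn (p q j : nat) :
  (p + q == j)%N%:R = \sum_(i < j.+1) (p == i)%:R * (q == j - i)%N%:R :> R.
Proof.
have [pj|jp] := leqP p j; last first.
  rewrite gtn_eqF ?big1 //; last exact: ltn_addr.
  move=> i _; rewrite gtn_eqF ?mul0r //.
  by apply: leq_ltn_trans jp; rewrite -ltnS.
rewrite (bigD1 (Ordinal (pj : (p < j.+1)%N))) //= eqxx mul1r big1.
  by rewrite addr0 -[in RHS](eqn_add2l p) subnKC.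
by move=> i; rewrite -val_eqE /= eq_sym => /negbTE ->; rewrite mul0r.
Qed.

Lemma park_one_indicator (n j : nat) :
  (n - 1 == j)%N%:R = park_one (fun i => (n == i)%:R) j :> R.
Proof.
by case: n => [|[|n]]; case: j => [|j] //=; rewrite ?addr0 ?add0r.
Qed.

Definition lost_egf (V : seq vertex) (j : nat) :=
  egf V (fun s => (lost [::] s == j)%:R).

(** An empty list stands for an absent subtree, so one operation covers zero, one and two
    children. *)
Definition graft (V1 V2 : seq vertex) : seq vertex :=
  [::] :: [seq 0%N :: v | v <- V1] ++ [seq 1%N :: v | v <- V2].

Lemma child_part_map i s : child_part i (map (cons i) s) = s.
Proof. by elim: s => //= v s ->; rewrite eqxx. Qed.

Lemma child_part_filter i (a : pred vertex) s : (forall u, a (i :: u)) ->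
  child_part i (seq.filter a s) = child_part i s.
Proof.
move=> ai; elim: s => //= -[|j v] s IH.
  by case: (a _) => /=; rewrite IH.
case: (eqVneq j i) => [->|ji]; first by rewrite ai /= eqxx IH.
by case: (a _) => /=; rewrite IH ?(negbTE ji).
Qed.

Definition root_arrivals (s : seq vertex) : nat :=
  count_mem [::] s + (lost [::] (child_part 0 s) + lost [::] (child_part 1 s)).

Lemma lost_egf_graft V1 V2 j m : lost_egf (graft V1 V2) j m =
  park_one (fun i => egf (graft V1 V2) (fun s => (root_arrivals s == i)%:R) m) j.
Proof.
rewrite /lost_egf (eq_egf (g := fun s =>
   park_one (fun i => (root_arrivals s == i)%:R) j)); last first.
  move=> s sV; rewrite -park_one_indicator (lost_rec (K := 2)).
    by rewrite !big_ord_recr big_ord0.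
  apply: sub_all sV => v /=; rewrite in_cons mem_cat.
  by case/or3P => [/eqP ->//|/mapP[u _ ->]|/mapP[u _ ->]].
by case: j => [|j] //=; rewrite /egf -mulrDl -big_split.
Qed.

(** Two uses of [egf_cat]: the predicate [a] separates the root from the rest, then [b] separates
    the left subtree from the right. Only one word of each length stays at the root, hence the
    weight $1/m!$. *)
Lemma root_arrivals_egf V1 V2 j m :
  egf (graft V1 V2) (fun s => (root_arrivals s == j)%:R) m =
  \sum_(i < j.+1) convn (fun m => (m == i)%:R / m`!%:R)
    (fun m => \sum_(k < (j - i)%N.+1)
       convn (lost_egf V1 k) (lost_egf V2 (j - i - k)%N) m) m.
Proof.
pose a (v : vertex) := v == [::].
pose b (v : vertex) := if v is i :: _ then i == 0%N else false.
pose L0 s := lost [::] (child_part 0 s).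
pose L1 s := lost [::] (child_part 1 s).
pose F (i : nat) s : R := (size (seq.filter a s) == i)%:R *
  (L0 (seq.filter (predC a) s) + L1 (seq.filter (predC a) s) == j - i)%N%:R.
rewrite (eq_egf (g := fun s => \sum_(i < j.+1) F i s)); last first.
  move=> s _; rewrite indicator_addn; apply: eq_bigr => i _.
  by rewrite /F size_filter /L0 /L1 !child_part_filter.
rewrite egf_sum; apply: eq_bigr => i _; rewrite /F /graft -cat1s.
rewrite (egf_cat (fun s => (size s == i)%:R)
   (fun s => (L0 s + L1 s == j - i)%N%:R)) //; last first.
  by rewrite all_cat !all_map; apply/andP; split; apply/allP.
apply: eq_conv => k _.
  rewrite /egf (eq_big_seq (fun=> (k == i)%:R)); last first.
    by move=> s; rewrite mem_words => /andP[/eqP ->].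
  by rewrite big_const_seq count_predT size_words exp1n /= addr0.
pose G (l : nat) s : R := (L0 (seq.filter b s) == l)%:R *
  (L1 (seq.filter (predC b) s) == j - i - l)%N%:R.
rewrite (eq_egf (g := fun s => \sum_(l < (j - i)%N.+1) G l s)).
  rewrite egf_sum; apply: eq_bigr => l _; rewrite /G.
  rewrite (egf_cat (fun s => (L0 s == l)%:R) (fun s => (L1 s == j - i - l)%N%:R)).
  - apply: eq_conv => k' _; rewrite egf_map /lost_egf /egf; congr (_ / _);
      apply: eq_bigr => s _ /=; by rewrite /L0 /L1 child_part_map.
  - by rewrite all_map; apply/allP.
  - by rewrite all_map; apply/allP.
move=> s _; rewrite indicator_addn; apply: eq_bigr => l _.
by rewrite /G /L0 /L1 !child_part_filter.
Qed.

Lemma lost_egf0 V j : lost_egf V j 0 = (j == 0%N)%:R.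
Proof. by rewrite /lost_egf /egf /= big_seq1 fact0 divr1 eq_sym. Qed.

(** The overflow law under Poisson arrivals without the normalizing factor $e^{-a|V|}$, which
    [size_law] restores. *)
Definition car_law (a : R) V (z : nat -> R) :=
  forall j, sums (fun m => lost_egf V j m * a ^+ m) (z j).

Lemma car_law0 a : car_law a [::] (fun j => (j == 0%N)%:R).
Proof.
move=> j; have /iffLR := sums_behead (fun m => lost_egf [::] j m * a ^+ m) 0.
rewrite lost_egf0 expr0 mulr1 addr0; apply; apply: sums0 => m.
have words0 : words m.+1 ([::] : seq vertex) = [::].
  by apply: size0nil; rewrite size_words exp0n.
by rewrite /lost_egf /egf words0 big_nil !mul0r.
Qed.

Lemma car_law_graft a V1 V2 z1 z2 : 0 <= a ->
  car_law a V1 z1 -> car_law a V2 z2 ->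
  car_law a (graft V1 V2) (park_one (convn (exp_coeff a) (convn z1 z2))).
Proof.
move=> a0 h1 h2.
have pos V j m : 0 <= lost_egf V j m * a ^+ m.
  by rewrite mulr_ge0 ?exprn_ge0 // egf_ge0.
have hr j : sums (fun m => egf (graft V1 V2)
    (fun s => (root_arrivals s == j)%:R) m * a ^+ m)
    (convn (exp_coeff a) (convn z1 z2) j).
  pose p i m := (m == i)%:R / m`!%:R * a ^+ m.
  pose c2 i m := convn (fun m => lost_egf V1 i.1 m * a ^+ m)
                       (fun m => lost_egf V2 i.2 m * a ^+ m) m.
  have hp i : sums (p i) (exp_coeff a i).
    have -> : exp_coeff a i = \sum_(m < i.+1) p i m.
      rewrite big_ord_recr big1 /= ?add0r /p ?eqxx ?mul1r /exp_coeff /=.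
        by rewrite mulrC.
      by move=> k _; rewrite ltn_eqF // !mul0r.
    by apply: sums_finite => n ni; rewrite /p gtn_eqF // !mul0r.
  apply: (@eq_sums _ (fun m => \sum_(i < j.+1) convn (p i)
     (fun m => \sum_(k < (j - i)%N.+1) c2 (nat_of_ord k, (j - i - k)%N) m) m)).
    move=> m; rewrite root_arrivals_egf mulr_suml; apply: eq_bigr => i _.
    rewrite -convn_pow; apply: eq_conv => m' _ //.
    by rewrite mulr_suml; apply: eq_bigr => k _; rewrite /c2 convn_pow.
  apply: (sums_sum
    (f := fun i => convn (p i) (fun m =>
       \sum_(k < (j - i)%N.+1) c2 (nat_of_ord k, (j - i - k)%N) m))
    (S := fun i => exp_coeff a i * convn z1 z2 (j - i)%N)) => i _.
  apply: sums_conv => //.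
  - move=> m; rewrite /p mulr_ge0 ?exprn_ge0 // divr_ge0 //.
  - move=> m; apply: sumr_ge0 => k _; apply: sumr_ge0 => l _.
    by rewrite mulr_ge0 // pos.
  apply: (sums_sum (f := fun k => c2 (k, (j - i - k)%N))
    (S := fun k => z1 k * z2 (j - i - k)%N)) => k _.
  by apply: sums_conv => [m|m||]; rewrite ?pos.
move=> j.
apply: (@eq_sums _ (park_one (fun i m => egf (graft V1 V2)
    (fun s => (root_arrivals s == i)%:R) m * a ^+ m) j)).
  by move=> m; rewrite lost_egf_graft; case: j => [|j] //=; rewrite mulrDl.
by case: j => [|j] /=; [apply: sumsD; apply: hr | apply: hr].
Qed.

End exponential_generating_functions.

(** * Binary trees *)

Section binary_trees.

(** The [nseq] contributes the empty list of children exactly when [n] is 0. *)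
Definition child_lists (T : nat -> seq tree) (n : nat) : seq (seq tree) :=
  [seq [::] | _ <- nseq (n == 0)%N tt] ++ ([seq [:: t] | t <- T n]
  ++ flatten [seq [seq [:: t1; t2] | t1 <- T k, t2 <- T (n - k)%N]
             | k <- iota 0 n.+1]).

Lemma eq_child_lists T T' n : (forall k, (k <= n)%N -> T k = T' k) ->
  child_lists T n = child_lists T' n.
Proof.
move=> TT'; rewrite /child_lists TT' //.
congr (_ ++ (_ ++ flatten _)); apply/eq_in_map => k.
by rewrite (mem_iota 0 n.+1) add0n => /= kn; rewrite !TT' ?leq_subr.
Qed.

(** Here [d] is fuel; by [trees_recE] every [d >= n] gives the same list. *)
Fixpoint trees_rec (d n : nat) : seq tree :=
  if (d, n) is (d'.+1, n'.+1) then map Node (child_lists (trees_rec d') n')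
  else [::].

Definition trees (n : nat) : seq tree := trees_rec n n.

Lemma trees_recE d n : (n <= d)%N -> trees_rec d n = trees n.
Proof.
elim/ltn_ind: n d => -[|n] IH [|d] // nd; rewrite /trees.
rewrite -[LHS]/(map Node (child_lists (trees_rec d) n)).
rewrite -[RHS]/(map Node (child_lists (trees_rec n) n)).
congr (map Node _); apply: eq_child_lists => k kn.
by rewrite !IH // (leq_trans kn).
Qed.

Lemma treesS n : trees n.+1 = map Node (child_lists trees n).
Proof.
rewrite -[LHS]/(map Node (child_lists (trees_rec n) n)).
by congr (map Node _); apply: eq_child_lists => k; exact: trees_recE.
Qed.

Lemma big_trees (A : nmodType) n (F : seq tree -> A) :
  \sum_(t <- trees n.+1) (let: Node ts := t in F ts) =
  F [::] *+ (n == 0)%N + \sum_(t <- trees n) F [:: t] +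
  \sum_(k < n.+1) \sum_(t1 <- trees k) \sum_(t2 <- trees (n - k)%N) F [:: t1; t2].
Proof.
rewrite treesS big_map /child_lists big_cat big_cat -[RHS]addrA; congr (_ + (_ + _)).
- by case: (n == 0)%N; rewrite ?big_map ?big_seq1 ?big_nil //= big_nil.
- by rewrite big_map.
rewrite -(big_mkord xpredT (fun k => \sum_(t1 <- trees k)
  \sum_(t2 <- trees (n - k)%N) F [:: t1; t2])) /index_iota subn0.
move: (iota 0 n.+1) => I; rewrite big_flatten big_map /=.
by apply: eq_bigr => k _; rewrite big_allpairs_dep.
Qed.

Lemma vertices_graft t1 t2 :
  [/\ vertices (Node [::]) = graft [::] [::],
      vertices (Node [:: t1]) = graft (vertices t1) [::] &
      vertices (Node [:: t1; t2]) = graft (vertices t1) (vertices t2)].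
Proof. by split; rewrite //= ?cats0. Qed.

Lemma size_graft V1 V2 : size (graft V1 V2) = (size V1 + size V2).+1.
Proof. by rewrite /graft /= size_cat !size_map. Qed.

Lemma graft_uniq V1 V2 : uniq V1 -> uniq V2 -> uniq (graft V1 V2).
Proof.
move=> u1 u2; rewrite /graft /= mem_cat cat_uniq !map_inj_uniq ?u1 ?u2 /=;
  try by move=> x y [].
rewrite andbT; apply/andP; split.
  by apply/norP; split; apply/negP => /mapP[].
by apply/hasPn => _ /mapP[v _ ->] /=; apply/negP => /mapP[].
Qed.

Lemma mem_child_lists trees n ts : ts \in child_lists trees n ->
  [\/ ts = [::] /\ n = 0%N, exists2 t, ts = [:: t] & t \in trees n |
   exists k t1 t2, [/\ (k <= n)%N, ts = [:: t1; t2], t1 \in trees k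
                     & t2 \in trees (n - k)%N]].
Proof.
rewrite mem_cat mem_cat => /or3P[|/mapP[t tn ->]|/flatten_mapP[k kn]].
- by case: eqP => [->|//] /mapP[_ _ ->]; apply: Or31.
- by apply: Or32; exists t.
case/allpairsP => -[t1 t2] [t1k t2k ->]; apply: Or33; exists k, t1, t2; split=> //.
by move: kn; rewrite mem_iota.
Qed.

Lemma mem_trees n t : t \in trees n ->
  tree_size t = n /\ uniq (vertices t).
Proof.
elim/ltn_ind: n t => -[|n] IH t //; rewrite treesS => /mapP[ts tsn ->].
rewrite /tree_size; case: (mem_child_lists tsn).
- by case=> -> ->.
- case=> t' -> t'n; have [_ -> _] := vertices_graft t' t'.
  have [<- u] := IH n (ltnSn n) _ t'n.
  by rewrite size_graft addn0 graft_uniq.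
case=> k [t1 [t2 [kn -> t1k t2k]]]; have [_ _ ->] := vertices_graft t1 t2.
have [e1 u1] := IH k kn _ t1k.
have [e2 u2] := IH (n - k)%N (leq_subr _ _ : (n - k < n.+1)%N) _ t2k.
rewrite size_graft graft_uniq //; split=> //.
by move: e1 e2; rewrite /tree_size => -> ->; rewrite subnKC.
Qed.

Lemma flatten_map_uniq (T U : eqType) (s : seq T) (F : T -> seq U) (h : U -> T) :
  uniq s -> (forall k, k \in s -> uniq (F k)) ->
  (forall k x, k \in s -> x \in F k -> h x = k) ->
  uniq (flatten [seq F k | k <- s]).
Proof.
elim: s => //= k s IH /andP[ks us] uF hF; rewrite cat_uniq uF ?mem_head //=.
rewrite IH ?andbT //.
- apply/hasPn => x /flatten_mapP[l ls xl]; apply/negP => xk.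
  move: ks; rewrite -(hF k x) ?mem_head // (hF l x) ?ls //.
  by rewrite in_cons ls orbT.
- by move=> l ls; apply: uF; rewrite in_cons ls orbT.
by move=> l x ls; apply: hF; rewrite in_cons ls orbT.
Qed.

Lemma trees_uniq n : uniq (trees n).
Proof.
elim/ltn_ind: n => -[//|n] IH; rewrite treesS map_inj_uniq; last by move=> x y [].
rewrite /child_lists cat_uniq [uniq (_ ++ flatten _)]cat_uniq; apply/and3P; split.
- by case: (n == 0)%N.
- apply/hasPn => ts; rewrite mem_cat => tsn; apply/negP => /mapP[_ _ e].
  move: tsn; rewrite e => /orP[/mapP[t _ //]|/flatten_mapP[k _]].
  by case/allpairsP => -[t1 t2] [].
apply/and3P; split.
- by rewrite map_inj_uniq ?IH // => x y [].
- apply/hasPn => ts /flatten_mapP[k _ /allpairsP[[t1 t2] [_ _ ->]]].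
  by apply/negP => /mapP[].
(* The split [k] is recovered from a pair of children as the size of the first one. *)
apply: (flatten_map_uniq (h := fun ts => tree_size (head (Node [::]) ts))).
- exact: iota_uniq.
- move=> k; rewrite (mem_iota 0 n.+1) add0n => /= kn.
  apply: allpairs_uniq; [by rewrite IH | by rewrite IH // ltnS leq_subr|].
  by move=> [x1 x2] [y1 y2] _ _ [-> ->].
move=> k _ _ /allpairsP[[t1 t2] [/= t1k _ ->]].
by have [] := mem_trees t1k.
Qed.

End binary_trees.

(** * Weights of the branching process *)

Section offspring.
Context {R : realType}.

Definition bgw_weight : tree -> R := gw_pmf (binomial_pmf 2 2^-1).

Lemma bgw_weightE ts : bgw_weight (Node ts) =
  (4^-1 *+ 'C(2, size ts)) * \prod_(t <- ts) bgw_weight t.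
Proof.
rewrite /bgw_weight /= big_map /binomial_pmf; congr (_ * _).
have [h|h] := leqP (size ts) 2; last by rewrite bin_small.
have -> : unstable.onem 2^-1 = 2^-1 :> R by rewrite /unstable.onem; field.
by rewrite -exprD subnKC //; congr (_ *+ _); field.
Qed.

Lemma bgw_weight_ge0 t : 0 <= bgw_weight t.
Proof.
move: t; fix IH 1 => -[ts]; rewrite bgw_weightE; apply: mulr_ge0.
  by rewrite mulrn_wge0 // invr_ge0.
elim: ts => [|t ts IHts]; first by rewrite big_nil.
by rewrite big_cons mulr_ge0.
Qed.

(** A vertex with more than two children makes the weight vanish through the binomial coefficient,
    so the finite list [trees n] carries all the mass of size [n]. *)
Lemma bgw_weight_neq0 t : bgw_weight t != 0 -> t \in trees (tree_size t).
Proof.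
move eqn : (tree_size t) => n.
elim/ltn_ind: n t eqn => n IH [ts] szn; rewrite bgw_weightE mulf_eq0 negb_or.
case: ts szn => [|t1 [|t2 [|t3 ts]]].
- by move=> <- _; apply/mapP; exists [::].
- have [_ e _] := vertices_graft t1 t1.
  rewrite /tree_size e size_graft addn0 big_seq1 => szn /andP[_ w1].
  rewrite -szn treesS; apply: map_f; rewrite mem_cat mem_cat; apply/or3P/Or32.
  by apply: map_f; apply: (IH _ _ t1) => //; rewrite -szn.
- have [_ _ e] := vertices_graft t1 t2.
  rewrite /tree_size e size_graft big_cons big_seq1 mulf_eq0 negb_or.
  move=> en /and3P[_ w1 w2].
  rewrite -en treesS; apply: map_f; rewrite mem_cat mem_cat; apply/or3P/Or33.
  apply/flatten_mapP; exists (size (vertices t1)).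
    by rewrite (mem_iota 0 _.+1) add0n ltnS leq_addr.
  rewrite addKn; apply: (allpairs_f (fun t1 t2 => [:: t1; t2])).
    by apply: (IH _ _ t1) => //; rewrite -en ltnS leq_addr.
  by apply: (IH _ _ t2) => //; rewrite -en ltnS leq_addl.
by move=> _; rewrite bin_small // mulr0n eqxx.
Qed.

End offspring.

(** * Linearity of convolutions and of [park_one] *)

Section convolution_sums.
Context {A : comPzRingType}.

Lemma convn_suml (I : Type) (s : seq I) (w : I -> A) (F : I -> nat -> A) g n :
  convn (fun i => \sum_(t <- s) w t * F t i) g n
  = \sum_(t <- s) w t * convn (F t) g n.
Proof.
rewrite /convn; under eq_bigr do rewrite mulr_suml.
rewrite exchange_big; apply: eq_bigr => t _; rewrite mulr_sumr.
by apply: eq_bigr => i _; rewrite mulrA.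
Qed.

Lemma convn_sumr (I : Type) (s : seq I) (w : I -> A) (F : I -> nat -> A) g n :
  convn g (fun i => \sum_(t <- s) w t * F t i) n
  = \sum_(t <- s) w t * convn g (F t) n.
Proof.
rewrite convC convn_suml; apply: eq_bigr => t _; congr (_ * _); exact: convC.
Qed.

Lemma convnZ (k l : A) (f g : nat -> A) n :
  convn (fun i => k * f i) (fun i => l * g i) n = k * l * convn f g n.
Proof. by rewrite /convn mulr_sumr; apply: eq_bigr => i _; rewrite mulrACA. Qed.

Lemma convnZl (k : A) (f g : nat -> A) n :
  convn (fun i => k * f i) g n = k * convn f g n.
Proof. by rewrite /convn mulr_sumr; apply: eq_bigr => i _; rewrite mulrA. Qed.

Lemma convnZr (k : A) (f g : nat -> A) n :
  convn g (fun i => k * f i) n = k * convn g f n.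
Proof. by rewrite convC convnZl convC. Qed.

Lemma convnDl (f f' g : nat -> A) n :
  convn (fun i => f i + f' i) g n = convn f g n + convn f' g n.
Proof. by rewrite /convn -big_split; apply: eq_bigr => i _; rewrite mulrDl. Qed.

Lemma convnDr (f f' g : nat -> A) n :
  convn g (fun i => f i + f' i) n = convn g f n + convn g f' n.
Proof. by rewrite convC convnDl !(convC g). Qed.

Definition delta0 (j : nat) : A := (j == 0%N)%:R.

Lemma convn_delta0 f n : convn delta0 f n = f n.
Proof.
rewrite /convn big_ord_recl /delta0 mul1r subn0 big1 ?addr0 // => i _.
by rewrite mul0r.
Qed.

Lemma park_oneZ (k : A) f j : k * park_one f j = park_one (fun i => k * f i) j.
Proof. by case: j => [|j] //=; rewrite mulrDr. Qed.

Lemma park_one_sum (I : Type) (s : seq I) (w : I -> A) (F : I -> nat -> A) j :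
  \sum_(t <- s) w t * park_one (F t) j
  = park_one (fun i => \sum_(t <- s) w t * F t i) j.
Proof.
case: j => [|j] //=; rewrite -big_split; apply: eq_bigr => t _.
exact: mulrDr.
Qed.

Lemma eq_park_one (f g : nat -> A) j : f =1 g -> park_one f j = park_one g j.
Proof. by move=> fg; case: j => [|j] /=; rewrite !fg. Qed.

End convolution_sums.

(** * The overflow of the random tree *)

Section parking_on_trees.
Context {R : realType} (a : R).

(** The default [delta0] of [nth] is the law of an absent subtree, from which no car leaves. *)
Fixpoint tree_law (t : tree) : nat -> R :=
  let: Node ts := t in let zs := map tree_law ts in
  park_one (convn (exp_coeff a) (convn (nth delta0 zs 0) (nth delta0 zs 1))).

Definition child_law (ts : seq tree) : nat -> R :=
  convn (exp_coeff a) (convn (nth delta0 (map tree_law ts) 0)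
                             (nth delta0 (map tree_law ts) 1)).

Lemma tree_lawP n t : 0 <= a -> t \in trees n -> car_law a (vertices t) (tree_law t).
Proof.
move=> a0; elim/ltn_ind: n t => -[|n] IH t //; rewrite treesS => /mapP[ts tsn ->].
have l0 := car_law0 a.
case: (mem_child_lists tsn).
- by case=> -> _; have [-> _ _] := vertices_graft t t; exact: car_law_graft.
- case=> t' -> t'n; have [_ -> _] := vertices_graft t' t'.
  by apply: car_law_graft => //; exact: (IH n).
case=> k [t1 [t2 [kn -> t1k t2k]]]; have [_ _ ->] := vertices_graft t1 t2.
apply: car_law_graft => //; first exact: (IH k).
by apply: (IH (n - k)%N) => //; rewrite ltnS leq_subr.
Qed.

Definition forest_law (n j : nat) : R :=
  \sum_(t <- trees n) bgw_weight t * tree_law t j.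

(** The exponential normalizes the Poisson arrivals at [n] vertices. The [delta0] term adds the
    empty tree, which [overflow_law] has at size 0 and [trees 0] lacks. *)
Definition size_law (n j : nat) : R :=
  expR (- a) ^+ n * (forest_law n j + delta0 n * delta0 j).

Lemma sum_delta0 (n : nat) (F : nat -> R) :
  \sum_(k < n.+1) delta0 (n - k)%N * F k = F n.
Proof.
rewrite big_ord_recr /= subnn mul1r big1 ?add0r // => i _.
by rewrite /delta0 subn_eq0 leqNgt ltn_ord mul0r.
Qed.

(** Separating the empty tree on both sides leaves four terms: no child, a left child only, a right
    child only, two children. *)
Lemma sum_convn_size_law n i :
  \sum_(k < n.+1) convn (size_law k) (size_law (n - k)%N) i =
  expR (- a) ^+ n * (delta0 n * delta0 i + forest_law n i + forest_law n i +
    \sum_(k < n.+1) convn (forest_law k) (forest_law (n - k)%N) i).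
Proof.
transitivity (\sum_(k < n.+1) expR (- a) ^+ n * (
   delta0 (n - k)%N * (delta0 k * delta0 i + forest_law k i)
   + delta0 k * forest_law (n - k)%N i
   + convn (forest_law k) (forest_law (n - k)%N) i)).
  apply: eq_bigr => k _; rewrite /size_law convnZ -exprD subnKC -1?ltnS //.
  congr (_ * _); rewrite convnDl !convnDr !convnZl !convnZr.
  by rewrite [convn _ delta0 _]convC !convn_delta0; ring.
rewrite -mulr_sumr; congr (_ * _); rewrite !big_split /=; congr (_ + _).
rewrite (sum_delta0 n (fun k => delta0 k * delta0 i + forest_law k i)).
congr (_ + _); rewrite -[RHS](sum_delta0 n (forest_law^~ i)).
rewrite (reindex_inj rev_ord_inj) /=.
apply: eq_bigr => k _; rewrite subSS.
have kn : (k <= n)%N by rewrite -ltnS.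
by rewrite subKn.
Qed.

(** The offspring probabilities 1/4, 1/2, 1/4 are 1/4 times the number of ways to place the children
    left or right. Hence plane trees with these weights match binary trees with weight 1/4 per
    vertex. *)
Lemma size_law_overflow : overflow_law 4^-1 (poisson_wt a) size_law.
Proof.
split=> [j|n j].
  by rewrite /size_law /forest_law big_nil expr0 mul1r add0r mul1r.
rewrite /size_law [delta0 n.+1]/= /forest_law.
have -> : \sum_(t <- trees n.+1) bgw_weight t * tree_law t j =
    park_one (fun i => \sum_(t <- trees n.+1)
      bgw_weight t * (let: Node ts := t in child_law ts i)) j.
  by rewrite -park_one_sum; apply: eq_bigr => -[ts].
rewrite [delta0 _]mulr0n mul0r addr0 park_oneZ; apply: eq_park_one => i.
transitivity (expR (- a) ^+ n.+1 * \sum_(t <- trees n.+1)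
   (let: Node ts := t in bgw_weight (Node ts) * child_law ts i)).
  by congr (_ * _); apply: eq_bigr => -[ts].
rewrite big_trees /arrivals /poisson_wt.
have -> : convn (fun i => expR (- a) * exp_coeff a i)
    (fun i => \sum_(k < n.+1) convn (size_law k) (size_law (n - k)%N) i) i =
  expR (- a) ^+ n.+1 * convn (exp_coeff a)
    (fun i => delta0 n * delta0 i + forest_law n i + forest_law n i +
      \sum_(k < n.+1) convn (forest_law k) (forest_law (n - k)%N) i) i.
  rewrite exprS -convnZ; apply: eq_conv => // l _; exact: sum_convn_size_law.
rewrite mulrCA; congr (_ * _).
rewrite !convnDr convnZr 3!mulrDr; congr (_ + _).
  rewrite -[RHS]addrA; congr (_ + _).
    rewrite bgw_weightE big_nil mulr1 /child_law /= [convn _ delta0 _]convC.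
    rewrite convn_delta0 /delta0; case: eqP => _; rewrite /= ?mul1r ?mul0r ?mulr0 //.
    congr (_ * _); rewrite -[RHS]convn_delta0 [RHS]convC.
    by apply: eq_conv => // l _; rewrite convn_delta0.
  rewrite /forest_law convn_sumr -mulrDl -mulr2n mulr_sumr.
  apply: eq_bigr => t _; rewrite bgw_weightE big_seq1 -mulrA.
  congr (_ * (_ * _)); apply: eq_conv => // l _ /=.
  by rewrite convC convn_delta0.
(* A weight 1 is inserted in each term to give the sum the shape that [convn_sumr] expects. *)
rewrite -[X in convn _ X](funext (fun i => eq_bigr _ (fun k _ => mul1r _))).
rewrite convn_sumr mulr_sumr; apply: eq_bigr => k _; rewrite mul1r.
rewrite (eq_conv (g' := fun l => \sum_(t1 <- trees k) bgw_weight t1 *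
    convn (tree_law t1) (forest_law (n - k)%N) l) (fun _ _ => erefl)); last first.
  by move=> l _; rewrite convn_suml.
rewrite convn_sumr mulr_sumr; apply: eq_bigr => t1 _.
rewrite (eq_conv (g' := fun l => \sum_(t2 <- trees (n - k)%N) bgw_weight t2 *
    convn (tree_law t1) (tree_law t2) l) (fun _ _ => erefl)); last first.
  by move=> l _; rewrite convn_sumr.
rewrite convn_sumr !mulr_sumr; apply: eq_bigr => t2 _.
rewrite bgw_weightE big_cons big_seq1 [size _]/= binn mulr1n /child_law /=.
by rewrite -!mulrA.
Qed.

End parking_on_trees.

Lemma sum_bgw_weight (R : realType) n :
  \sum_(t <- trees n) bgw_weight t + (n == 0%N)%:R = catalan4 n :> R.
Proof.
(* Without cars, i.e. at a = 0, the law of the overflow is concentrated at 0. *)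
have law0 : forall j, size_law (0 : R) n j = (j == 0%N)%:R *
    (\sum_(t <- trees n) bgw_weight t + (n == 0%N)%:R).
  move=> j; rewrite /size_law oppr0 expR0 expr1n mul1r mulrDr; congr (_ + _).
    rewrite /forest_law mulr_sumr; apply: eq_big_seq => t tn.
    rewrite mulrC; congr (_ * _).
    have h := tree_lawP (lexx (0 : R)) tn j; apply: (sums_unique h).
    have /iffLR := sums_behead (fun m => lost_egf (vertices t) j m * (0 : R) ^+ m) 0.
    rewrite lost_egf0 expr0 mulr1 addr0.
    by apply; apply: sums0 => m; rewrite exprS mul0r mulr0.
  by rewrite /delta0 mulrC.
have h := sums_overflow1 (lexx (0 : R)) (size_law_overflow (0 : R)) n.
apply: sums_unique _ h.
have /iffLR := sums_behead (size_law (0 : R) n) 0.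
rewrite law0 mul1r addr0; apply; apply: sums0 => j.
by rewrite law0 mul0r.
Qed.

(** * From Poisson arrivals to a fixed number of cars *)

Section poisson_sandwich.
Context {R : realType}.

(** The exponential moment of a Poisson variable: its generating function at $e^u$. *)
Lemma sums_poisson_tilt (lam u k : R) :
  sums (fun m => poisson_wt lam m * expR (u * (m%:R - k)))
       (expR (lam * (expR u - 1) - u * k)).
Proof.
rewrite expRD mulrC.
apply: (eq_sums _ (sumsZ (expR (- (u * k))) (sums_poisson_wt lam (expR u)))) => m.
rewrite mulrBr expRD expRM_natr; ring.
Qed.

Variables (lam u Q : R) (p : nat -> R).
Hypothesis lam_ge0 : 0 <= lam.
Hypothesis p_itv : forall m, 0 <= p m <= 1.
Hypothesis p_homo : {homo p : m n / (m <= n)%N >-> n <= m}.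
Hypothesis pQ : sums (fun m => poisson_wt lam m * p m) Q.

Let wt_ge0 m : 0 <= poisson_wt lam m.
Proof. exact: poisson_wt_ge0. Qed.

Let sums_wt (c : R) : sums (fun m => poisson_wt lam m * c) c.
Proof.
have := sumsZ c (sums_poisson_wt lam 1); rewrite subrr mulr0 expR0 mulr1.
by apply: eq_sums => m; rewrite expr1n mulr1 mulrC.
Qed.

(** Monotonicity gives $p_M \le p_m + 1_{m > M}$, and the indicator is at most $e^{u(m-M-1)}$. The
    shift by one is used later, where $\alpha n \le M + 1$. *)
Lemma poissonized_upper M : 0 <= u ->
  p M <= Q + expR (lam * (expR u - 1) - u * M.+1%:R).
Proof.
move=> u0; have hE := sums_poisson_tilt lam u M.+1%:R.
apply: ler_sums (sums_wt (p M)) (sumsD pQ hE) => m.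
  have /andP[pm0 _] := p_itv m.
  by apply: addr_ge0; apply: mulr_ge0; rewrite ?expR_ge0 ?wt_ge0.
rewrite -mulrDr ler_wpM2l ?wt_ge0 //; have [mM|Mm] := leqP m M.
  by rewrite ler_wpDr ?expR_ge0 //; exact: p_homo.
have /andP[_ pM1] := p_itv M; have /andP[pm0 _] := p_itv m.
rewrite ler_wpDl // (le_trans pM1) // -[leLHS]expR0 ler_expR mulr_ge0 //.
by rewrite subr_ge0 ler_nat.
Qed.

(** The mirror bound $p_m \le p_M + 1_{m < M}$, with the indicator at most $e^{u(m-M)}$ for $u \le
    0$. *)
Lemma poissonized_lower M : u <= 0 ->
  Q <= p M + expR (lam * (expR u - 1) - u * M%:R).
Proof.
move=> u0; have hE := sums_poisson_tilt lam u M%:R.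
apply: ler_sums pQ (sumsD (sums_wt (p M)) hE) => m.
  have /andP[pm0 _] := p_itv M.
  by apply: addr_ge0; apply: mulr_ge0; rewrite ?expR_ge0 ?wt_ge0.
rewrite -mulrDr ler_wpM2l ?wt_ge0 //; have [Mm|mM] := leqP M m.
  by rewrite ler_wpDr ?expR_ge0 //; exact: p_homo.
have /andP[pM0 _] := p_itv M; have /andP[_ pm1] := p_itv m.
rewrite ler_wpDl // (le_trans pm1) // -[leLHS]expR0 ler_expR.
by rewrite mulr_le0 // subr_le0 ler_nat ltnW.
Qed.

End poisson_sandwich.

Lemma sumr_const_size (V : nmodType) (I : Type) (s : seq I) (x : V) :
  \sum_(i <- s) x = x *+ size s.
Proof. by rewrite big_const_seq count_predT iter_addr_0. Qed.

Section fixed_number_of_cars.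
Context {R : realType}.

Definition parking_count (n m : nat) : R :=
  \sum_(t <- trees n) bgw_weight t *
    \sum_(s <- words m (vertices t)) (lost [::] s == 0)%N%:R.

Definition park_prob (n m : nat) : R :=
  parking_count n m / (catalan4 n * n%:R ^+ m).

(** The total number of cars is Poisson with mean $an$, and given this number the arrivals form a
    uniform word. *)
Lemma sums_park_prob (a : R) n : 0 <= a -> (0 < n)%N ->
  sums (fun m => poisson_wt (a * n%:R) m * park_prob n m)
       (size_law a n 0 / catalan4 n).
Proof.
move=> a0 n0; have nR : n%:R != 0 :> R by rewrite pnatr_eq0 -lt0n.
have h : sums (fun m => \sum_(t <- trees n)
    bgw_weight t * (lost_egf (vertices t) 0 m * a ^+ m)) (forest_law a n 0).
  rewrite /forest_law (big_nth (Node [::])) big_mkord.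
  apply: (@eq_sums _ (fun m => \sum_(i < size (trees n))
     bgw_weight (nth (Node [::]) (trees n) i) *
     (lost_egf (vertices (nth (Node [::]) (trees n) i)) 0 m * a ^+ m))).
    by move=> m; rewrite (big_nth (Node [::])) big_mkord.
  apply: (sums_sum (f := fun i m => bgw_weight (nth (Node [::]) (trees n) i) *
     (lost_egf (vertices (nth (Node [::]) (trees n) i)) 0 m * a ^+ m))
    (S := fun i => bgw_weight (nth (Node [::]) (trees n) i) *
       tree_law a (nth (Node [::]) (trees n) i) 0%N)) => i szi.
  by apply: sumsZ; apply: (tree_lawP a0 (n := n)); exact: mem_nth.
have -> : size_law a n 0 / catalan4 n =
    expR (- (a * n%:R)) / catalan4 n * forest_law a n 0.
  have -> : size_law a n 0 = expR (- a) ^+ n * forest_law a n 0.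
    by rewrite /size_law [delta0 n]/delta0 eqn0Ngt n0 mul0r addr0.
  by rewrite -mulNr expRM_natr; ring.
apply: (eq_sums _ (sumsZ _ h)) => m.
rewrite /park_prob /parking_count /poisson_wt /exp_coeff /= exprMn.
rewrite [in RHS]mulr_suml !mulr_sumr; apply: eq_bigr => t _.
rewrite /lost_egf /egf; field.
by rewrite expf_neq0 // (gt_eqF (catalan4_gt0 _)) pnatr_eq0 -lt0n fact_gt0.
Qed.

Lemma park_prob_itv n m : (0 < n)%N -> 0 <= park_prob n m <= 1.
Proof.
move=> n0; have cn : 0 < catalan4 n * n%:R ^+ m :> R.
  by rewrite mulr_gt0 ?catalan4_gt0 // exprn_gt0 // ltr0n.
rewrite /park_prob; apply/andP; split.
  rewrite divr_ge0 ?(ltW cn) // sumr_ge0 // => t _.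
  by rewrite mulr_ge0 ?bgw_weight_ge0 ?sumr_ge0.
rewrite ler_pdivrMr // mul1r.
have := sum_bgw_weight R n; rewrite eqn0Ngt n0 addr0 => <-.
rewrite mulr_suml /parking_count !big_seq; apply: ler_sum => t tn.
rewrite ler_wpM2l ?bgw_weight_ge0 //.
have [<- _] := mem_trees tn; rewrite -natrX -size_words.
rewrite -sumr_const_size.
by apply: ler_sum => s _; rewrite lern1 leq_b1.
Qed.

(** Every word has [n] extensions by one letter, and if an extension parks, so does the word
    itself. *)
Lemma park_prob_homo n : (0 < n)%N ->
  {homo (park_prob n) : m m' / (m <= m')%N >-> m' <= m}.
Proof.
move=> n0; apply: (@homo_leq _ _ (fun x y : R => y <= x)) => [//| m k l|m].
  by move=> h1 h2; exact: le_trans h2 h1.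
have nR : 0 < n%:R :> R by rewrite ltr0n.
have cn : 0 < catalan4 n * n%:R ^+ m :> R.
  by rewrite mulr_gt0 ?catalan4_gt0 // exprn_gt0.
rewrite /park_prob exprSr mulrA invfM mulrA ler_pdivrMr //.
rewrite mulrAC ler_wpM2r ?invr_ge0 ?(ltW cn) //.
rewrite /parking_count mulr_suml !big_seq; apply: ler_sum => t tn.
rewrite -mulrA ler_wpM2l ?bgw_weight_ge0 //.
have [<- _] := mem_trees tn; rewrite big_wordsS mulrC mulr_natl -sumr_const_size.
apply: ler_sum => v _; apply: ler_sum => s _; rewrite ler_nat.
rewrite -!all_cars_park_lost.
by case: (boolP (all_cars_park (rcons s v))) => // /all_cars_park_rcons ->.
Qed.

End fixed_number_of_cars.

(** * Chernoff bounds around $\alpha n$ cars *)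

Section limit_fixed_number_of_cars.
Context {R : realType}.

Definition park_limit (a : R) : R :=
  expR (a / 2) * Num.sqrt ((a ^+ 2 - 4 * a + 2) / (2 * (1 - a))).

Lemma park_limit_continuous (a : R) : a < 1 -> {for a, continuous park_limit}.
Proof.
move=> a1; apply: cvgM.
  apply: (cvg_comp (fun x : R => x / 2) expR); last exact: continuous_expR.
  by apply: cvgM; [exact: cvg_id | exact: cvg_cst].
apply: (cvg_comp (fun x : R => (x ^+ 2 - 4 * x + 2) / (2 * (1 - x))) Num.sqrt);
  last exact: sqrt_continuous.
apply: cvgM.
  have h : is_derive a 1 (fun x : R => x ^+ 2 - 4 * x + 2) (2 * a - 4).
    by apply: is_derive_eq; rewrite /GRing.scale /=; ring.
  case: h => /derivable1_diffP/differentiable_continuous h _; exact: h.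
apply: cvgV; first by rewrite mulf_neq0 // subr_eq0 gt_eqF.
apply: cvgM; first exact: cvg_cst.
by apply: cvgB; [exact: cvg_cst | exact: cvg_id].
Qed.

Lemma poissonized_cvg (a : R) : 0 <= a -> a < 2 - Num.sqrt 2 ->
  size_law a n 0 / catalan4 n @[n --> \oo] --> park_limit a.
Proof.
move=> a0 a_sub; have z_law := size_law_overflow a.
have h := park_prob_cvg a0 z_law.
rewrite /park_limit -(park_prob_limit a0 a_sub z_law h); exact: h.
Qed.

(** The factor per vertex in the Chernoff bound for a Poisson variable of mean $an$ at $\alpha n$,
    with the optimal tilt $u = \ln(\alpha/a)$. It is below 1 because $e^{-u} > 1 - u$ for $u \ne
    0$. *)
Lemma chernoff_rate (alpha a : R) : 0 < a -> 0 < alpha -> a != alpha ->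
  0 < expR (alpha - a - alpha * ln (alpha / a)) < 1.
Proof.
move=> a0 al0 ne; rewrite expR_gt0 expR_lt1 /=.
have q0 : 0 < alpha / a by rewrite divr_gt0.
set u := ln (alpha / a).
have eu : expR u = alpha / a by rewrite lnK // posrE.
have u0 : - u != 0.
  apply/negP; rewrite oppr_eq0 => /eqP e; move: eu; rewrite e expR0 => /esym e1.
  by move: ne; rewrite -[alpha](divfK (lt0r_neq0 a0)) e1 mul1r eqxx.
have := expR_gt1Dx u0; rewrite expRN eu invf_div => h.
have : alpha * (1 - u) < a by rewrite mulrC -ltr_pdivlMr.
by lra.
Qed.

Variable alpha : R.
Hypothesis alpha_gt0 : 0 < alpha.
Let M n := Num.truncn (alpha * n%:R).

Let M_itv n : (M n)%:R <= alpha * n%:R <= (M n).+1%:R.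
Proof.
have /truncn_itv/andP[h1 h2] : 0 <= alpha * n%:R by rewrite mulr_ge0 // ltW.
by rewrite h1 ltW.
Qed.

Lemma park_prob_eventually_le (a eps : R) : 0 < a -> a < alpha ->
  a < 2 - Num.sqrt 2 -> 0 < eps ->
  \forall n \near \oo, park_prob n (M n) <= park_limit a + eps.
Proof.
move=> a0 aal a_sub eps0.
pose u := ln (alpha / a); pose r := expR (alpha - a - alpha * u).
have /andP[r0 r1] : 0 < r < 1 := chernoff_rate a0 alpha_gt0 (negbT (lt_eqF aal)).
have hQ := poissonized_cvg (ltW a0) a_sub.
have hr : r ^+ n @[n --> \oo] --> (0 : R).
  by apply: cvg_expr; rewrite gtr0_norm.
have e2 : 0 < eps / 2 by rewrite divr_gt0.
near=> n.
have n0 : (0 < n)%N by near: n; exact: nbhs_infty_gt.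
have h1 : `|park_limit a - size_law a n 0 / catalan4 n| <= eps / 2.
  by near: n; move/cvgrPdist_le: hQ; apply.
have h2 : `|0 - r ^+ n| <= eps / 2.
  by near: n; move/cvgrPdist_le: hr; apply.
have an0 : 0 <= a * n%:R by rewrite mulr_ge0 // ltW.
have eu : expR u = alpha / a by rewrite lnK // posrE divr_gt0.
have u0 : 0 <= u by rewrite ln_ge0 // ler_pdivlMr // mul1r ltW.
have h3 := poissonized_upper an0 (fun m => park_prob_itv m n0)
  (park_prob_homo n0) (sums_park_prob (ltW a0) n0) (M n) u0.
apply: (le_trans h3).
have h4 : expR (a * n%:R * (expR u - 1) - u * (M n).+1%:R) <= r ^+ n.
  rewrite -expRM_natr ler_expR eu.
  have -> : a * n%:R * (alpha / a - 1) = (alpha - a) * n%:R.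
    by field; rewrite gt_eqF.
  rewrite [leRHS]mulrBl lerD2l lerN2 [alpha * u]mulrC -mulrA ler_wpM2l //.
  by have /andP[] := M_itv n.
rewrite sub0r normrN gtr0_norm ?exprn_gt0 // in h2.
move: h1; rewrite ler_norml => /andP[h1 _].
by move: (size_law _ _ _ / _) (expR _) h1 h2 h4 => q e h1 h2 h4; lra.
Unshelve. all: by end_near. Qed.

Lemma park_prob_eventually_ge (a eps : R) : alpha < a ->
  a < 2 - Num.sqrt 2 -> 0 < eps ->
  \forall n \near \oo, park_limit a - eps <= park_prob n (M n).
Proof.
move=> ala a_sub eps0; have a0 := lt_trans alpha_gt0 ala.
pose u := ln (alpha / a); pose r := expR (alpha - a - alpha * u).
have /andP[r0 r1] : 0 < r < 1 := chernoff_rate a0 alpha_gt0 (negbT (gt_eqF ala)).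
have hQ := poissonized_cvg (ltW a0) a_sub.
have hr : r ^+ n @[n --> \oo] --> (0 : R).
  by apply: cvg_expr; rewrite gtr0_norm.
have e2 : 0 < eps / 2 by rewrite divr_gt0.
near=> n.
have n0 : (0 < n)%N by near: n; exact: nbhs_infty_gt.
have h1 : `|park_limit a - size_law a n 0 / catalan4 n| <= eps / 2.
  by near: n; move/cvgrPdist_le: hQ; apply.
have h2 : `|0 - r ^+ n| <= eps / 2.
  by near: n; move/cvgrPdist_le: hr; apply.
have an0 : 0 <= a * n%:R by rewrite mulr_ge0 // ltW.
have eu : expR u = alpha / a by rewrite lnK // posrE divr_gt0.
have u0 : u <= 0 by rewrite ln_le0 // ler_pdivrMr // mul1r ltW.
have h3 := poissonized_lower an0 (fun m => park_prob_itv m n0)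
  (park_prob_homo n0) (sums_park_prob (ltW a0) n0) (M n) u0.
have h4 : expR (a * n%:R * (expR u - 1) - u * (M n)%:R) <= r ^+ n.
  rewrite -expRM_natr ler_expR eu.
  have -> : a * n%:R * (alpha / a - 1) = (alpha - a) * n%:R.
    by field; rewrite gt_eqF.
  rewrite [leRHS]mulrBl lerD2l lerN2 [alpha * u]mulrC -mulrA ler_wnM2l //.
  by have /andP[] := M_itv n.
rewrite sub0r normrN gtr0_norm ?exprn_gt0 // in h2.
move: h1; rewrite ler_norml => /andP[_ h1].
by move: (size_law _ _ _ / _) (expR _) h1 h2 h3 h4 => q e h1 h2 h3 h4; lra.
Unshelve. all: by end_near. Qed.

End limit_fixed_number_of_cars.

(** * The limit on both sides of the threshold *)

Section phase_transition.
Context {R : realType}.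

Let sqrt2_bounds : 1 < Num.sqrt 2 :> R /\ Num.sqrt 2 < 2 :> R.
Proof.
have s0 := sqrtr_ge0 (2 : R); have s2 := sqr_sqrtr (ler0n R 2).
split; first by rewrite -[ltLHS]sqrtr1 ltr_sqrt ?ltr1n.
by rewrite ltNge; apply/negP => h; move: s2; nra.
Qed.

Lemma park_limit_critical : park_limit (2 - Num.sqrt 2 : R) = 0.
Proof.
have s2 := sqr_sqrtr (ler0n R 2); rewrite /park_limit.
have -> : (2 - Num.sqrt 2 : R) ^+ 2 - 4 * (2 - Num.sqrt 2) + 2 = 0.
  by transitivity (Num.sqrt 2 ^+ 2 - 2 : R); [ring | rewrite s2 subrr].
by rewrite mul0r sqrtr0 mulr0.
Qed.

Lemma park_prob_cvg_limit (alpha : R) : 0 <= alpha ->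
  park_prob n (Num.truncn (alpha * n%:R)) @[n --> \oo] -->
    (if alpha <= 2 - Num.sqrt 2 then park_limit alpha else 0).
Proof.
have [s1 s2] := sqrt2_bounds.
rewrite le_eqVlt => /orP[/eqP <-|al0].
  (* The Chernoff bounds require positive [alpha]; for [alpha = 0] there are no cars and the
     probability is 1. *)
  have -> : (0 : R) <= 2 - Num.sqrt 2 by lra.
  have -> : park_limit 0 = 1 :> R.
    rewrite /park_limit mul0r expR0 mul1r expr0n mulr0 !subr0 add0r mulr1.
    by rewrite divff // sqrtr1.
  apply: cvg_near_cst; near=> n.
  have n0 : (0 < n)%N by near: n; exact: nbhs_infty_gt.
  rewrite mul0r truncn0 /park_prob /parking_count expr0 mulr1 /=.
  have -> : \sum_(t <- trees n) bgw_weight t *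
      \sum_(s <- [:: [::]]) (lost [::] s == 0)%N%:R = catalan4 n :> R.
    rewrite -sum_bgw_weight eqn0Ngt n0 addr0; apply: eq_bigr => t _.
    by rewrite big_seq1 mulr1.
  by rewrite divff // gt_eqF ?catalan4_gt0.
apply/cvgrPdist_le => eps eps0.
have e2 : 0 < eps / 2 by rewrite divr_gt0.
have p_itv : \forall n \near \oo, 0 <= park_prob n (Num.truncn (alpha * n%:R)) :> R.
  near=> n; have n0 : (0 < n)%N by near: n; exact: nbhs_infty_gt.
  by have /andP[] :=
    park_prob_itv (R := R) (Num.truncn (alpha * n%:R)) n0.
have [al_sub|al_sup] := ltP alpha (2 - Num.sqrt 2).
  rewrite (ltW al_sub).
  have al1 : alpha < 1 by lra.
  have hc := park_limit_continuous al1.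
  have H1 : \forall a \near alpha^'-,
      (`|park_limit alpha - park_limit a| <= eps / 2 /\ a < alpha) /\ 0 < a.
    near=> a; split; last by near: a; exact: nbhs_left_gt.
    split; last by near: a; exact: nbhs_left_lt.
    near: a; have := cvg_at_left_filter hc; move/cvgrPdist_le; exact.
  have H2 : \forall a \near alpha^'+,
      (`|park_limit alpha - park_limit a| <= eps / 2 /\ alpha < a)
      /\ a < 2 - Num.sqrt 2.
    near=> a; split; last by near: a; exact: nbhs_right_lt.
    split; last by near: a; exact: nbhs_right_gt.
    near: a; have := cvg_at_right_filter hc; move/cvgrPdist_le; exact.
  (* Continuity of [park_limit] provides densities [a1 < alpha < a2] whose limits are within
     [eps / 2] of the desired value. *)
  have [a1 [[h1 a1al] a10]] := filter_ex (FF := at_left_proper_filter alpha) H1.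
  have [a2 [[h2 ala2] a2c]] := filter_ex (FF := at_right_proper_filter alpha) H2.
  have a1c := lt_trans a1al al_sub.
  near=> n.
  have h3 : park_prob n (Num.truncn (alpha * n%:R)) <= park_limit a1 + eps / 2.
    by near: n; exact: park_prob_eventually_le.
  have h4 : park_limit a2 - eps / 2 <= park_prob n (Num.truncn (alpha * n%:R)).
    by near: n; exact: park_prob_eventually_ge.
  move: h1 h2; rewrite !ler_norml => /andP[h1 _] /andP[_ h2].
  by apply/andP; split; lra.
(* The value is 0 at the threshold too, so from there on an upper bound suffices, taken at a density
   just below the threshold. *)
have -> : (if alpha <= 2 - Num.sqrt 2 then park_limit alpha else 0) = 0.
  case: ifP => // h; have -> : alpha = 2 - Num.sqrt 2.
    by apply/eqP; rewrite eq_le h al_sup.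
  exact: park_limit_critical.
have ac1 : 2 - Num.sqrt 2 < 1 :> R by lra.
have ac0 : 0 < 2 - Num.sqrt 2 :> R by lra.
have hc := park_limit_continuous ac1.
have H : \forall a \near (2 - Num.sqrt 2 : R)^'-,
    (`|park_limit (2 - Num.sqrt 2) - park_limit a| <= eps / 2
     /\ a < 2 - Num.sqrt 2) /\ 0 < a.
  near=> a; split; last by near: a; exact: nbhs_left_gt.
  split; last by near: a; exact: nbhs_left_lt.
  near: a; have := cvg_at_left_filter hc; move/cvgrPdist_le; exact.
have [a [[h1 a1c] a0]] :=
  filter_ex (FF := at_left_proper_filter (2 - Num.sqrt 2)) H.
have aal := lt_le_trans a1c al_sup.
near=> n.
have h3 : park_prob n (Num.truncn (alpha * n%:R)) <= park_limit a + eps / 2.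
  by near: n; exact: park_prob_eventually_le.
have h4 : 0 <= park_prob n (Num.truncn (alpha * n%:R)) :> R by near: n.
rewrite sub0r normrN ger0_norm //.
move: h1; rewrite park_limit_critical sub0r normrN => /ler_normlW h1.
by lra.
Unshelve. all: by end_near. Qed.

End phase_transition.

(** * The probability space *)

Section conditioned_law.
Context {R : realType}.

(** Trees of size [n] outside [trees n] have weight 0, which leaves a finite sum. *)
Lemma BGW_size n : (0 < n)%N ->
  BGW 2 (2^-1 : R) [set t | tree_size t = n] = (catalan4 n)%:E.
Proof.
move=> n0; rewrite /BGW /gw_law (esumID [set` trees n]); last first.
  by move=> t _; rewrite lee_fin bgw_weight_ge0.
rewrite [X in (_ + X)%E]esum1 ?adde0; last first.
  move=> t [/= tn /negP tt]; apply/eqP; rewrite eqe; apply: contraNT tt.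
  by rewrite -tn; exact: bgw_weight_neq0.
have -> : [set t | tree_size t = n] `&` [set` trees n] = [set` trees n].
  apply/seteqP; split=> [t []//|t tn]; split=> //=.
  by have [] := mem_trees tn.
rewrite esum_fset; [|exact: finite_seq
  |by move=> t _; rewrite lee_fin bgw_weight_ge0].
rewrite -fsbig_seq ?trees_uniq // sumEFin; congr (_%:E).
by rewrite -(sum_bgw_weight R n) eqn0Ngt n0 addr0.
Qed.

Lemma conditioned_BGW_size n t : (0 < n)%N -> t \in trees n ->
  conditioned (BGW 2 (2^-1 : R)) [set t' | tree_size t' = n] [set t] =
  bgw_weight t / catalan4 n.
Proof.
move=> n0 tn; rewrite /conditioned BGW_size //=; congr (_ / _).
have -> : [set t] `&` [set t' | tree_size t' = n] = [set t].
  apply/seteqP; split=> [u []//|u ->]; split=> //=.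
  by have [] := mem_trees tn.
by rewrite /BGW /gw_law esum_set1 // lee_fin bgw_weight_ge0.
Qed.

End conditioned_law.

Section random_arrivals.
Context {R : realType} d (Omega : measurableType d) (P : probability Omega R).
Variables (n m : nat) (T : {RV P >-> tree}) (X : 'I_m -> {RV P >-> vertex}).
Hypothesis n_gt0 : (0 < n)%N.
Hypothesis T_law : is_conditioned_BGW n T.
Hypothesis X_law : iid_uniform_given T X.

Let arrivals_at w := [seq X i w | i <- enum 'I_m].

Let size_arrivals w : size (arrivals_at w) = m.
Proof. by rewrite size_map size_enum_ord. Qed.

Let arrivalsE w s : size s = m ->
  arrivals_at w = s <-> forall i : 'I_m, X i w = nth [::] s i.
Proof.
move=> sm; have E (i : 'I_m) : nth [::] (arrivals_at w) i = X i w.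
  by rewrite (nth_map i) ?size_enum_ord // nth_ord_enum.
split=> [<- i|h]; first by rewrite E.
apply: (@eq_from_nth _ [::]); first by rewrite size_arrivals sm.
move=> i; rewrite size_arrivals => im; by rewrite (E (Ordinal im)) h.
Qed.

Let arrivals_measurable s : measurable [set w | arrivals_at w = s].
Proof.
have [sm|sm] := eqVneq (size s) m; last first.
  rewrite (_ : [set w | _] = set0) //; apply/seteqP; split=> // w /= e.
  by move: sm; rewrite -e size_arrivals eqxx.
have -> : [set w | arrivals_at w = s] =
    \bigcap_(i in [set: 'I_m]) X i @^-1` [set nth [::] s i].
  apply/seteqP; split=> w /=; first by move=> /(arrivalsE w sm) h i _; exact: h.
  by move=> h; apply/(arrivalsE w sm) => i; exact: h.
apply: fin_bigcap_measurable => [|i _]; first exact: finite_finset.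
exact: measurable_funPTI.
Qed.

Let E (ts : tree * seq vertex) : set Omega :=
  [set w | T w = ts.1 /\ arrivals_at w = ts.2].

Let E_measurable ts : measurable (E ts).
Proof.
rewrite (_ : E ts = T @^-1` [set ts.1] `&` [set w | arrivals_at w = ts.2]) //.
by apply: measurableI; [exact: measurable_funPTI | exact: arrivals_measurable].
Qed.

Let E_prob t s : t \in trees n -> s \in words m (vertices t) ->
  P (E (t, s)) = (bgw_weight t / (catalan4 n * n%:R ^+ m))%:E.
Proof.
move=> tn; rewrite mem_words => /andP[/eqP sm sV].
have -> : E (t, s) = [set w | T w = t /\ forall i, X i w = nth [::] s i].
  by apply/seteqP; split=> w [Tw h]; split=> //; apply/(arrivalsE w sm).
rewrite X_law T_law conditioned_BGW_size // -EFinM; congr (_%:E).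
have [tsz _] := mem_trees tn.
rewrite (eq_bigr (fun=> n%:R^-1)); last first.
  by move=> i _; rewrite /uniform_vertex (allP sV) ?tsz // mem_nth ?sm.
by rewrite prodr_const card_ord exprVn invfM mulrA.
Qed.

Let outcomes : seq (tree * seq vertex) :=
  [seq (t, s) | t <- trees n, s <- words m (vertices t)].

Let outcomes_uniq : uniq outcomes.
Proof.
apply: allpairs_uniq_dep; first exact: trees_uniq.
  by move=> t tn; apply: words_uniq; have [] := mem_trees tn.
by move=> [t s] [t' s'] _ _ /= [-> ->].
Qed.

Let E_union (a : pred (seq vertex)) :
  P (\bigcup_(ts in [set` [seq ts <- outcomes | a ts.2]]) E ts) =
  ((\sum_(t <- trees n) bgw_weight t *
     \sum_(s <- words m (vertices t)) (a s)%:R) / (catalan4 n * n%:R ^+ m))%:E.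
Proof.
rewrite measure_fin_bigcup; [|exact: finite_seq
  |by move=> [t s] [t' s'] _ _ [w [[/= <- <-] [/= <- <-]]] |by []].
rewrite -fsbig_seq ?filter_uniq //= big_filter big_mkcond /outcomes.
rewrite big_allpairs_dep /=.
rewrite mulr_suml -sumEFin; apply: eq_big_seq => t tn.
rewrite mulrAC mulr_sumr -sumEFin; apply: eq_big_seq => s sn /=.
by case: (a s); rewrite ?mulr1 ?mulr0 // E_prob.
Qed.

(** The hypotheses give the probabilities of the atoms [E]. Favourable atoms make up [G], inside the
    event, and unfavourable ones make up [B], inside its complement; as their probabilities add up
    to 1, the event is squeezed. *)
Lemma prob_all_park : P (all_park_event X) = (park_prob n m)%:E.
Proof.
have nR : n%:R ^+ m != 0 :> R by rewrite expf_neq0 // pnatr_eq0 -lt0n.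
(* The event is a countable union of measurable sets, since there are countably many words of
   vertices. *)
have mA : measurable (all_park_event X).
  have -> : all_park_event X = \bigcup_(s in [set: seq vertex])
      (if all_cars_park s then [set w | arrivals_at w = s] else set0).
    apply/seteqP; split=> [w ew|w [s _]].
      by exists (arrivals_at w) => //; rewrite (ew : all_cars_park (arrivals_at w)).
    by case: ifP => // + e; rewrite -(e : arrivals_at w = s).
  apply: countable_bigcupT_measurable => [|s]; first exact: countableP.
  by case: ifP => // _; exact: arrivals_measurable.
pose G := \bigcup_(ts in [set` [seq ts <- outcomes | all_cars_park ts.2]]) E ts.
pose B := \bigcup_(ts in [set` [seq ts <- outcomes | ~~ all_cars_park ts.2]]) E ts.
have mG : measurable G by apply: fin_bigcup_measurable.
have mB : measurable B by apply: fin_bigcup_measurable.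
have GA : G `<=` all_park_event X.
  move=> w [[t s] /=]; rewrite mem_filter => /andP[/= h _] [_ /= e].
  by rewrite /all_park_event /= -/(arrivals_at w) e.
have BA : B `<=` ~` all_park_event X.
  move=> w [[t s] /=]; rewrite mem_filter => /andP[/= /negP h _] [_ /= e].
  by rewrite /all_park_event /= -/(arrivals_at w) e.
have PG : P G = (park_prob n m)%:E.
  rewrite E_union; congr (_%:E); rewrite /park_prob /parking_count.
  congr (_ / _); apply: eq_bigr => t _; congr (_ * _).
  by apply: eq_bigr => s _; rewrite all_cars_park_lost.
have PB : P B = (1 - park_prob n m)%:E.
  rewrite (E_union (fun s => ~~ all_cars_park s)); congr (_%:E).
  apply/eqP; rewrite eq_sym subr_eq addrC; apply/eqP.
  rewrite /park_prob /parking_count -mulrDl -big_split /=.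
  rewrite [X in X / _](_ : _ = catalan4 n * n%:R ^+ m).
    by rewrite divff // mulf_neq0 // gt_eqF ?catalan4_gt0.
  rewrite -(sum_bgw_weight R n) eqn0Ngt n_gt0 addr0 mulr_suml.
  apply: eq_big_seq => t tn; rewrite -mulrDr -big_split /=; congr (_ * _).
  have [<- _] := mem_trees tn; rewrite -natrX -size_words -sumr_const_size.
  apply: eq_bigr => s _; rewrite -all_cars_park_lost.
  by case: (all_cars_park s); rewrite ?addr0 ?add0r.
apply/eqP; rewrite eq_le -{2}PG le_measure ?inE // andbT.
have : (P B <= P (~` all_park_event X))%E.
  by rewrite le_measure ?inE //; exact: measurableC.
rewrite PB probability_setC //.
have := probability_le1 P mA; have := measure_ge0 P (all_park_event X).
case: (P (all_park_event X)) => [r||] //= _ _; last by rewrite leNye.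
by rewrite -EFinB !lee_fin lerD2l lerN2.
Qed.

End random_arrivals.

Theorem theorem3p1 (R : realType) (alpha : R)
  (d : nat -> measure_display)
  (Omega : forall n : nat, measurableType (d n))
  (P : forall n : nat, probability (Omega n) R)
  (T : forall n : nat, {RV (P n) >-> tree})
  (X : forall n : nat,
      'I_(Num.truncn (alpha * n%:R)) -> {RV (P n) >-> vertex})
  (halpha : 0 <= alpha)
  (hT : forall n : nat, (1 <= n)%N -> is_conditioned_BGW n (T n))
  (hX : forall n : nat, (1 <= n)%N -> iid_uniform_given (T n) (X n)) :
  P n (all_park_event (X n)) @[n --> \oo] -->
    (if alpha <= 2 - Num.sqrt 2
     then expR (alpha / 2) *
          Num.sqrt ((alpha ^+ 2 - 4 * alpha + 2) / (2 * (1 - alpha)))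
     else 0)%:E.
Proof.
have h := park_prob_cvg_limit halpha.
have : (park_prob n (Num.truncn (alpha * n%:R)))%:E @[n --> \oo] -->
    (if alpha <= 2 - Num.sqrt 2 then park_limit alpha else 0)%:E.
  by apply: cvg_EFin h; exact: nearW.
apply: cvg_trans; apply: near_eq_cvg; near=> n.
have n0 : (0 < n)%N by near: n; exact: nbhs_infty_gt.
by rewrite (prob_all_park n0 (hT n n0) (hX n n0)).
Unshelve. all: by end_near. Qed.
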